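(* Let $\mathbb{K}$ be a field of characteristic $0$ and let $F(u)\equiv F(t,u)\in\mathbb{K}(u)[[t]]$ be a power series in $t$ whose coefficients are rational functions of $u$ without pole at $u=0$. Define $\Delta F(u)=\frac{F(u)-F(0)}{u}$ and $\Delta^{(i)}$ as the $i$-fold iterate of $\Delta$. Suppose that $$F(u)=F_0(u)+t\,\mathcal{Q}\big(F(u),\Delta F(u),\Delta^{(2)}F(u),\dots,\Delta^{(k)}F(u),t;u\big)$$ for some $k\ge0$, some $F_0(u)\in\mathbb{K}(u)$, and some $\mathcal{Q}(y_0,\dots,y_k,t;v)$ which is a polynomial in $y_0,\dots,y_k,t$ and a rational function in $v$, with coefficients in $\mathbb{K}$. Then $F(t,u)$ is algebraic over $\mathbb{K}(t,u)$.
   Context: A series is algebraic over $\mathbb{K}(t,u)$ if it satisfies a non-trivial polynomial equation with coefficients in $\mathbb{K}(t,u)$. *)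

(* Defs.v *)
From HB Require Import structures.
From mathcomp Require Import all_boot all_order all_algebra.
From Stdlib Require Import ClassicalEpsilon.
Set Implicit Arguments. Unset Strict Implicit. Unset Printing Implicit Defensive.
Import Order.TTheory GRing.Theory Num.Theory.
Local Open Scope ring_scope.

Section Defs.
Variable K : fieldType.

Definition ratf := {fraction {poly K}}.

Definition rcst (c : K) : ratf := tofrac (c%:P).
Definition ru : ratf := tofrac 'X.

Definition nopole0 (f : ratf) : Prop :=
  exists p q : {poly K}, q.[0] != 0 /\ f = tofrac p / tofrac q.

Definition eval0 (f : ratf) : K :=
  epsilon (inhabits 0) (fun c => exists p q : {poly K},
     [/\ q.[0] != 0, f = tofrac p / tofrac q & c = p.[0] / q.[0]]).

Definition series := nat -> ratf.

Definition sconst (f : ratf) : series := fun n => if n == 0%N then f else 0.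
Definition sone : series := sconst 1.
Definition szero : series := fun _ => 0.
Definition sadd (F G : series) : series := fun n => F n + G n.
Definition sscal (c : ratf) (F : series) : series := fun n => c * F n.
Definition smul (F G : series) : series :=
  fun n => \sum_(i < n.+1) F i * G (n - i)%N.
Definition spow (F : series) (m : nat) : series := iter m (smul F) sone.
Definition tpow (m : nat) : series := fun n => if n == m then 1 else 0.
Definition polyser (p : {poly ratf}) : series := fun n => p`_n.

Definition Delta (F : series) : series :=
  fun n => (F n - rcst (eval0 (F n))) / ru.

(* A polynomial Q(y_0,...,y_k,t; v) in y_0..y_k, t with coefficients in K(v),
   given as a finite list of monomials  c(v) * y^e * t^m  encoded (c, (e, m)). *)
Definition multipoly (k : nat) := seq (ratf * ({ffun 'I_k.+1 -> nat} * nat)).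

Definition evalQ (k : nat) (Q : multipoly k) (F : series) : series :=
  foldr (fun (mon : ratf * ({ffun 'I_k.+1 -> nat} * nat)) (acc : series) =>
     sadd (sscal mon.1
            (smul (tpow mon.2.2)
               (foldr (fun (i : 'I_k.+1) (acc' : series) => smul (spow (iter i Delta F) (mon.2.1 i)) acc')
                      sone (enum 'I_k.+1))))
          acc)
    szero Q.

(* F is algebraic over K(t,u): a nonzero polynomial P(x) whose coefficients
   lie in K(u)[t] (equivalently, after clearing denominators, in K(t,u))
   annihilates F. *)
Definition algebraic_series (F : series) : Prop :=
  exists P : {poly {poly ratf}}, P != 0 /\
    forall n, \sum_(i < size P) smul (polyser P`_i) (spow F i) n = 0.

End Defs.

(* Main.v *)
Require Import Defs.
From HB Require Import structures.
From mathcomp Require Import all_boot all_order all_algebra.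
From mathcomp Require Import boolp classical_sets.
From mathcomp Require Import ring.
From Stdlib Require ClassicalEpsilon.
Set Implicit Arguments. Unset Strict Implicit. Unset Printing Implicit Defensive.
Import Order.TTheory GRing.Theory Num.Theory.
Local Open Scope ring_scope.

(** Let E = Frac K(u)[[t]].  In characteristic 0 it suffices to show that every
    derivation D of E that kills K(u) and t kills F.  Let f(v) be the expansion
    of F at u = 0, written in a new variable v: its coefficients F_i lie in
    K[[t]], and applying D to each of them turns the equation into the linear one
    d(v) G = t sum_j q_j(v) Delta^j G for G = sum_i D(F_i) v^i.  If G has a common
    denominator, its t-adic valuation is infinite, so D(F_i) = 0 for all i.  Then
    D(Delta^j F) = D(F)/u^j, and the original equation gives
    D(F) (1 - t (...)) = 0, that is D(F) = 0.

    The common denominator comes from Weierstrass division.  Let W be the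
    Weierstrass polynomial of the kernel B = d v^k - t sum_j q_j v^(k-j), and g
    the remainder of f modulo W^2 v^k.  The polynomial g solves the equation
    modulo W^2, so D(g), which has a common denominator, solves the linear
    equation modulo W; hence B divides the error, and G - D(g) is obtained by
    dividing by B.  This is the kernel method without its roots: no genericity
    assumption on the zeros of B is needed, whatever their multiplicities. *)

(** * Formal power series *)

(** A wrapper around coefficient functions, on which the convolution product can be registered as
    the ring product. *)
Record ps (R : Type) := PS { pcoef :> nat -> R }.

HB.instance Definition _ (R : Type) := gen_eqMixin (ps R).
HB.instance Definition _ (R : Type) := gen_choiceMixin (ps R).

Lemma psP (R : Type) (f g : ps R) : (forall n, f n = g n) -> f = g.
Proof. by case: f g => f [g] fg; congr PS; apply: funext. Qed.

Section PsRing.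
Variable R : comNzRingType.
Implicit Types f g h : ps R.

Definition ps_zero : ps R := PS (fun=> 0).
Definition ps_opp f : ps R := PS (fun n => - f n).
Definition ps_add f g : ps R := PS (fun n => f n + g n).
Definition ps_one : ps R := PS (fun n => (n == 0%N)%:R).
Definition ps_mul f g : ps R := PS (fun n => \sum_(i < n.+1) f i * g (n - i)%N).

Fact ps_addA : associative ps_add.
Proof. by move=> f g h; apply: psP => n /=; rewrite addrA. Qed.
Fact ps_addC : commutative ps_add.
Proof. by move=> f g; apply: psP => n /=; rewrite addrC. Qed.
Fact ps_add0 : left_id ps_zero ps_add.
Proof. by move=> f; apply: psP => n /=; rewrite add0r. Qed.
Fact ps_addN : left_inverse ps_zero ps_opp ps_add.
Proof. by move=> f; apply: psP => n /=; rewrite addNr. Qed.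

HB.instance Definition _ :=
  GRing.isZmodule.Build (ps R) ps_addA ps_addC ps_add0 ps_addN.

Definition ptrunc N f : {poly R} := \poly_(i < N) f i.

(* The product is computed on polynomial truncations, which transports the
   ring axioms from [{poly R}]. *)
Lemma ps_mulE N f g n : (n < N)%N -> ps_mul f g n = (ptrunc N f * ptrunc N g)`_n.
Proof.
move=> nN; rewrite coefM /=; apply: eq_bigr => i _.
rewrite !coef_poly (leq_ltn_trans (leq_subr _ _) nN).
by rewrite (leq_ltn_trans _ nN) // -ltnS.
Qed.

Fact ps_mulC : commutative ps_mul.
Proof.
by move=> f g; apply: psP => n; rewrite !(@ps_mulE n.+1) // mulrC.
Qed.

Lemma ps_mul_truncl f g h n :
  ps_mul (ps_mul f g) h n = (ptrunc n.+1 f * ptrunc n.+1 g * ptrunc n.+1 h)`_n.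
Proof.
rewrite coefM /=; apply: eq_bigr => i _.
rewrite [in RHS]coef_poly ltnS leq_subr; congr (_ * _).
exact: ps_mulE.
Qed.

Fact ps_mulA : associative ps_mul.
Proof.
move=> f g h; apply: psP => n; rewrite ps_mulC !ps_mul_truncl.
by rewrite mulrC mulrA.
Qed.

Fact ps_mul1 : left_id ps_one ps_mul.
Proof.
move=> f; apply: psP => n /=.
rewrite big_ord_recl /= mul1r subn0 big1 ?addr0 // => i _.
by rewrite mul0r.
Qed.

Fact ps_mulDl : left_distributive ps_mul ps_add.
Proof.
move=> f g h; apply: psP => n /=; rewrite -big_split /=.
by apply: eq_bigr => i _; rewrite mulrDl.
Qed.

Fact ps_1neq0 : ps_one != ps_zero.
Proof.
by apply/eqP => /(congr1 (fun f : ps R => f 0%N)) /= /eqP; rewrite oner_eq0.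
Qed.

HB.instance Definition _ := GRing.Zmodule_isComNzRing.Build (ps R)
  ps_mulA ps_mulC ps_mul1 ps_mulDl ps_1neq0.

Lemma psD f g n : (f + g) n = f n + g n. Proof. by []. Qed.
Lemma psB f g n : (f - g) n = f n - g n. Proof. by []. Qed.
Lemma ps0 n : (0 : ps R) n = 0. Proof. by []. Qed.
Lemma ps1 n : (1 : ps R) n = (n == 0%N)%:R. Proof. by []. Qed.
Lemma psM f g n : (f * g) n = \sum_(i < n.+1) f i * g (n - i)%N.
Proof. by []. Qed.
Lemma ps_sum (I : Type) (r : seq I) (P : pred I) (F : I -> ps R) n :
  (\sum_(i <- r | P i) F i) n = \sum_(i <- r | P i) F i n.
Proof. by apply: (big_morph (fun f : ps R => f n)). Qed.

Definition pC (c : R) : ps R := PS (fun n => if n == 0%N then c else 0).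
Definition pX : ps R := PS (fun n => (n == 1%N)%:R).
Definition pshift f : ps R := PS (fun n => f n.+1).

Lemma pCM c f n : (pC c * f) n = c * f n.
Proof.
rewrite psM big_ord_recl /= subn0 big1 ?addr0 // => i _.
by rewrite mul0r.
Qed.

Lemma pC_is_zmod : zmod_morphism pC.
Proof. by move=> c d; apply: psP => -[|n]; rewrite psB //= subrr. Qed.
Lemma pC_is_monoid : monoid_morphism pC.
Proof.
by split=> [|c d]; apply: psP => -[|n]; rewrite ?pCM //= mulr0.
Qed.
HB.instance Definition _ := GRing.isZmodMorphism.Build R (ps R) pC pC_is_zmod.
HB.instance Definition _ := GRing.isMonoidMorphism.Build R (ps R) pC pC_is_monoid.

Lemma pXM f n : (pX * f) n = if n is m.+1 then f m else 0.
Proof.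
case: n => [|n]; first by rewrite psM big_ord1 /= mul0r.
rewrite psM big_ord_recl /= mul0r add0r big_ord_recl /= mul1r.
rewrite subSS subn0 big1 ?addr0 // => i _.
by rewrite mul0r.
Qed.

Lemma pXnM N f n : (pX ^+ N * f) n = if (n < N)%N then 0 else f (n - N)%N.
Proof.
elim: N n => [|N IH] [|n]; rewrite ?expr0 ?mul1r ?subn0 //.
  by rewrite exprS -mulrA pXM.
by rewrite exprS -mulrA pXM IH ltnS subSS.
Qed.

Lemma pXn N n : (pX ^+ N) n = (n == N)%:R.
Proof.
rewrite -[pX ^+ N]mulr1 pXnM ps1; case: ltngtP => // nN.
- by rewrite subn_eq0 leqNgt nN.
- by rewrite nN subnn eqxx.
Qed.

Lemma iter_pshift j f n : iter j pshift f n = f (n + j)%N.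
Proof. by elim: j n => [|j IH] n; rewrite ?addn0 //= IH addSnnS. Qed.

Lemma iter_pshiftB j : {morph iter j pshift : f g / f - g}.
Proof. by move=> f g; apply: psP => n; rewrite psB !iter_pshift. Qed.

Lemma iter_pshift_CM j c f : iter j pshift (pC c * f) = pC c * iter j pshift f.
Proof. by apply: psP => n; rewrite pCM !iter_pshift pCM. Qed.

Lemma iter_pshift_XnM j N f : (j <= N)%N ->
  iter j pshift (pX ^+ N * f) = pX ^+ (N - j) * f.
Proof.
move=> jN; apply: psP => n; rewrite iter_pshift !pXnM ltn_subRL [(j + n)%N]addnC.
by rewrite subnBA.
Qed.

Lemma pXn_shift N f : (forall i, (i < N)%N -> f i = 0) ->
  f = pX ^+ N * iter N pshift f.
Proof.
move=> f0; apply: psP => n; rewrite pXnM; case: ltnP => [/f0//|Nn].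
by rewrite iter_pshift subnK.
Qed.

Lemma pX_shift f : f = pC (f 0%N) + pX * pshift f.
Proof. by apply: psP => -[|n]; rewrite psD pXM /= ?addr0 ?add0r. Qed.

(** * Truncation and series with finite support *)

Definition plow N f : ps R := PS (fun n => if (n < N)%N then f n else 0).

Lemma plowE N f n : plow N f n = if (n < N)%N then f n else 0.
Proof. by []. Qed.

Lemma plow_shift N f : f = plow N f + pX ^+ N * iter N pshift f.
Proof.
apply: psP => n; rewrite psD pXnM /=; case: ltnP => nN; first by rewrite addr0.
by rewrite add0r iter_pshift subnK.
Qed.

Definition ps_vanish M f := forall i, (M <= i)%N -> f i = 0.
Definition ps_ispoly f := exists M, ps_vanish M f.

Lemma ps_vanishW M N f : (M <= N)%N -> ps_vanish M f -> ps_vanish N f.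
Proof. by move=> MN fM i Ni; apply: fM; apply: leq_trans Ni. Qed.

Lemma ps_vanishB M f g : ps_vanish M f -> ps_vanish M g -> ps_vanish M (f - g).
Proof. by move=> fM gM i Mi; rewrite psB fM // gM // subrr. Qed.

Lemma ps_vanishM M N f g :
  ps_vanish M f -> ps_vanish N g -> ps_vanish (M + N) (f * g).
Proof.
move=> fM gN i MNi; rewrite psM big1 // => j _.
case: (leqP M j) => [/fM->|jM]; first by rewrite mul0r.
rewrite (gN _) ?mulr0 // leq_subRL ?ltnS //; last by rewrite -ltnS.
by apply: leq_trans MNi; rewrite leq_add2r ltnW.
Qed.

Lemma ispolyB f g : ps_ispoly f -> ps_ispoly g -> ps_ispoly (f - g).
Proof.
move=> [M fM] [N gN]; exists (maxn M N).
by apply: ps_vanishB; [apply: ps_vanishW fM | apply: ps_vanishW gN];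
  rewrite ?leq_maxl ?leq_maxr.
Qed.

Lemma ispolyM f g : ps_ispoly f -> ps_ispoly g -> ps_ispoly (f * g).
Proof. by move=> [M fM] [N gN]; exists (M + N)%N; apply: ps_vanishM. Qed.

Lemma ispolyC c : ps_ispoly (pC c).
Proof. by exists 1%N => -[]. Qed.

Lemma ispoly0 : ps_ispoly 0.
Proof. by exists 0%N. Qed.

Lemma ispolyN f : ps_ispoly f -> ps_ispoly (- f).
Proof. by move=> fp; rewrite -sub0r; apply/ispolyB/fp/ispoly0. Qed.

Lemma ispolyD f g : ps_ispoly f -> ps_ispoly g -> ps_ispoly (f + g).
Proof. by move=> fp gp; rewrite -[g]opprK; apply/ispolyB/ispolyN. Qed.

Lemma ispolyX N : ps_ispoly (pX ^+ N).
Proof. by exists N.+1 => i Ni; rewrite pXn gtn_eqF. Qed.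

Lemma ispoly_low N f : ps_ispoly (plow N f).
Proof. by exists N => i Ni; rewrite /= ltnNge Ni. Qed.

Lemma ispoly_shift j f : ps_ispoly f -> ps_ispoly (iter j pshift f).
Proof.
move=> [M fM]; exists M => i Mi; rewrite iter_pshift fM //.
by apply: leq_trans Mi (leq_addr _ _).
Qed.

(** The unit structure is required on the way to integral domains and fraction fields; inverses are
    picked by classical choice. *)
Definition ps_unit : {pred (ps R)} := fun f => `[< exists g, g * f = 1 >].
Definition ps_inv f : ps R :=
  if pselect (exists g, g * f = 1) is left H then projT1 (cid H) else f.

Fact ps_mulVx : {in ps_unit, left_inverse 1 ps_inv *%R}.
Proof.
move=> f /asboolP f_unit; rewrite /ps_inv; case: pselect => // H.
by case: cid.
Qed.

Fact ps_unitPl f g : g * f = 1 -> ps_unit f.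
Proof. by move=> gf; apply/asboolP; exists g. Qed.

Fact ps_inv_out : {in [predC ps_unit], ps_inv =1 id}.
Proof.
move=> f /negP fN; rewrite /ps_inv; case: pselect => // H; case: fN.
exact/asboolP.
Qed.

HB.instance Definition _ := GRing.ComNzRing_hasMulInverse.Build (ps R)
  ps_mulVx ps_unitPl ps_inv_out.

End PsRing.

Section PsIdomain.
Variable R : idomainType.

Lemma ps_neq0 (f : ps R) : f != 0 ->
  exists (N : nat) (g : ps R), g 0%N != 0 /\ f = pX R ^+ N * g.
Proof.
move=> f0; have ex : exists n, f n != 0.
  apply: contrapT => H; move/eqP: f0; apply; apply: psP => n.
  by apply/eqP; apply: contrapT => fn; apply: H; exists n; apply/negP.
case: (ex_minnP ex) => N fN minN; exists N, (iter N (@pshift R) f).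
rewrite iter_pshift; split=> //; apply: pXn_shift => i iN.
by apply/eqP; apply: contraLR iN => /minN; rewrite -leqNgt.
Qed.

(** The product of the two lowest nonzero coefficients is the coefficient of order [M + N]. *)
Fact ps_integral : GRing.integral_domain_axiom (ps R).
Proof.
move=> f g fg0; apply/norP => -[/ps_neq0 [M [f' [f0 fE]]] /ps_neq0 [N [g' [g0 gE]]]].
move/(congr1 (fun h : ps R => h (M + N)%N)): fg0.
rewrite fE gE mulrACA -exprD pXnM ltnn subnn psM big_ord1 ps0 /= => /eqP.
by rewrite mulf_eq0 (negPf f0) (negPf g0).
Qed.

HB.instance Definition _ := GRing.ComUnitRing_isIntegral.Build (ps R) ps_integral.
End PsIdomain.

Section PsMap.
Variables (R S : comNzRingType).

Definition ps_map (h : R -> S) (f : ps R) : ps S := PS (fun n => h (f n)).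

Variable h : {rmorphism R -> S}.

Fact ps_map_is_zmod : zmod_morphism (ps_map h).
Proof. by move=> f g; apply: psP => n; rewrite psB /= rmorphB. Qed.
Fact ps_map_is_monoid : monoid_morphism (ps_map h).
Proof.
split=> [|f g]; apply: psP => n; first by rewrite /= rmorph_nat.
by rewrite psM /= rmorph_sum; apply: eq_bigr => i _; rewrite rmorphM.
Qed.
HB.instance Definition _ :=
  GRing.isZmodMorphism.Build (ps R) (ps S) (ps_map h) ps_map_is_zmod.
HB.instance Definition _ :=
  GRing.isMonoidMorphism.Build (ps R) (ps S) (ps_map h) ps_map_is_monoid.

Lemma ps_mapC c : ps_map h (pC c) = pC (h c).
Proof. by apply: psP => -[|n] //=; rewrite rmorph0. Qed.

Lemma ps_mapX : ps_map h (pX R) = pX S.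
Proof. by apply: psP => n /=; rewrite rmorph_nat. Qed.

Lemma ps_map_shift j f :
  ps_map h (iter j (@pshift R) f) = iter j (@pshift S) (ps_map h f).
Proof. by apply: psP => n; rewrite /= !iter_pshift. Qed.

Lemma ps_map_inj : injective h -> injective (ps_map h).
Proof.
move=> inj_h f g fg; apply: psP => n; apply: inj_h.
exact: (congr1 (fun p : ps S => p n) fg).
Qed.

End PsMap.

(** * Derivations and algebraicity *)

Definition derivation (R : comNzRingType) (D : R -> R) : Prop :=
  (forall x y, D (x + y) = D x + D y) /\
  (forall x y, D (x * y) = D x * y + x * D y).

Section Derivation.
Variables (R : comNzRingType) (D : R -> R).
Hypothesis derD : derivation D.

Lemma derD0 : D 0 = 0.
Proof. by apply: (addIr (D 0)); rewrite -derD.1 addr0 add0r. Qed.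

Lemma derDB x y : D (x - y) = D x - D y.
Proof. by apply: (addIr (D y)); rewrite -derD.1 !subrK. Qed.

Lemma derD1 : D 1 = 0.
Proof.
by apply: (addIr (D 1)); rewrite add0r -[in RHS](mulr1 1) derD.2 mulr1 mul1r.
Qed.

Lemma derD_nat n : D n%:R = 0.
Proof. by elim: n => [|n IH]; rewrite ?derD0 // mulrS derD.1 derD1 IH addr0. Qed.

Lemma derD_sum (I : Type) (r : seq I) (F : I -> R) :
  D (\sum_(i <- r) F i) = \sum_(i <- r) D (F i).
Proof. exact: (big_morph D derD.1 derD0). Qed.

End Derivation.

(** * Derivations on subfields, as graphs *)

Section DerivationGraphs.
Variable E : fieldType.
Implicit Types (G : set (E * E)) (a b : E) (P Q : {poly E}).

(* The graph [{(x, D x)}] of a derivation [D] from a subfield of [E] to [E]: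
   a subfield of the dual numbers over [E] that meets [0 + E eps] trivially. *)
Record dgraph G : Prop := DGraph {
  dgraph1 : G (1, 0);
  dgraphB : forall x y x' y', G (x, y) -> G (x', y') -> G (x - x', y - y');
  dgraphM : forall x y x' y', G (x, y) -> G (x', y') ->
    G (x * x', y * x' + x * y');
  dgraphV : forall x y, x != 0 -> G (x, y) -> G (x^-1, - y / x ^+ 2);
  dgraph_fun : forall y, G (0, y) -> y = 0 }.

Section FractionGraph.
Variables (PP : {poly E} -> {poly E} -> Prop) (a b : E).

(** With [eps^2 = 0], this is the [eps] part of [(P + eps P1)(a + eps b)]. *)
Definition dual_eval P P1 := P1.[a] + P^`().[a] * b.

(** [PP P P1] is meant to say that [P1] is [P] with its coefficients differentiated; the second
    component is then the quotient rule for [P(a)/Q(a)], with [b] as derivative of [a]. *)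
Definition frac_graph : set (E * E) := fun xy => exists P P1 Q Q1,
  [/\ PP P P1, PP Q Q1, Q.[a] != 0, xy.1 = P.[a] / Q.[a] &
      xy.2 = (dual_eval P P1 * Q.[a] - P.[a] * dual_eval Q Q1) / Q.[a] ^+ 2].

Lemma dual_evalB P P1 Q Q1 :
  dual_eval (P - Q) (P1 - Q1) = dual_eval P P1 - dual_eval Q Q1.
Proof. by rewrite /dual_eval derivB !hornerE; ring. Qed.

Lemma dual_evalM P P1 Q Q1 : dual_eval (P * Q) (P1 * Q + P * Q1) =
  dual_eval P P1 * Q.[a] + P.[a] * dual_eval Q Q1.
Proof. by rewrite /dual_eval derivM !hornerE; ring. Qed.

Hypothesis PP1 : PP 1 0.
Hypothesis PPB : forall P P1 Q Q1, PP P P1 -> PP Q Q1 -> PP (P - Q) (P1 - Q1).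
Hypothesis PPM : forall P P1 Q Q1, PP P P1 -> PP Q Q1 ->
  PP (P * Q) (P1 * Q + P * Q1).
Hypothesis PPfun : forall P P1, PP P P1 -> P.[a] = 0 -> dual_eval P P1 = 0.

Lemma frac_graph_poly P P1 : PP P P1 -> frac_graph (P.[a], dual_eval P P1).
Proof.
move=> PPP; exists P, P1, 1, 0; rewrite /dual_eval derivC !hornerE oner_neq0.
by split=> //=; rewrite ?expr1n !divr1 // mulr0 mul0r subr0.
Qed.

(** Closure is arithmetic of dual numbers. [PPfun] makes the derivative single-valued: a fraction
    equal to 0 has a numerator vanishing at [a]. *)
Lemma frac_graph_dgraph : dgraph frac_graph.
Proof.
split.
- by have := frac_graph_poly PP1; rewrite /dual_eval derivC !hornerE.
- move=> x y x' y' [P [P1 [Q [Q1 [/= hP hQ Q0 -> ->]]]]].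
  move=> [P' [P1' [Q' [Q1' [/= hP' hQ' Q0' -> ->]]]]].
  exists (P * Q' - P' * Q), (P1 * Q' + P * Q1' - (P1' * Q + P' * Q1)).
  exists (Q * Q'), (Q1 * Q' + Q * Q1').
  rewrite dual_evalB !dual_evalM /= ?(hornerD, hornerN, hornerM) mulf_neq0 //.
  split=> //; [by apply: PPB; apply: PPM | by apply: PPM | |];
    by field; rewrite Q0 Q0'.
- move=> x y x' y' [P [P1 [Q [Q1 [/= hP hQ Q0 -> ->]]]]].
  move=> [P' [P1' [Q' [Q1' [/= hP' hQ' Q0' -> ->]]]]].
  exists (P * P'), (P1 * P' + P * P1'), (Q * Q'), (Q1 * Q' + Q * Q1').
  rewrite !dual_evalM /= ?(hornerD, hornerN, hornerM) mulf_neq0 //.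
  split=> //; [by apply: PPM | by apply: PPM | |];
    by field; rewrite Q0 Q0'.
- move=> x y x0 [P [P1 [Q [Q1 [/= hP hQ Q0 xE yE]]]]].
  have P0 : P.[a] != 0.
    by apply: contraNneq x0 => P0; rewrite xE P0 mul0r.
  exists Q, Q1, P, P1; rewrite /= xE yE; split=> //; first by rewrite invf_div.
  by field; rewrite Q0 P0.
- move=> y [P [P1 [Q [Q1 [/= hP hQ Q0 /esym/eqP PQ0 ->]]]]].
  move: PQ0; rewrite mulf_eq0 invr_eq0 (negPf Q0) orbF => /eqP P0.
  by rewrite P0 (PPfun hP P0) !mul0r subrr mul0r.
Qed.

End FractionGraph.

(** * Extension of a derivation to one more element *)

Section Extension.
Hypothesis charE : [pchar E] =i pred0.
Variable G : set (E * E).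
Hypothesis gG : dgraph G.

Definition poly_graph P P1 := forall i, G (P`_i, P1`_i).

Lemma dgraph0 : G (0, 0).
Proof. by have := dgraphB gG (dgraph1 gG) (dgraph1 gG); rewrite !subrr. Qed.

Lemma dgraphD x y x' y' : G (x, y) -> G (x', y') -> G (x + x', y + y').
Proof.
move=> xy xy'; have := dgraphB gG xy (dgraphB gG dgraph0 xy').
by rewrite !sub0r !opprK.
Qed.

Lemma poly_graphC x y : G (x, y) -> poly_graph x%:P y%:P.
Proof. by move=> xy i; rewrite !coefC; case: eqP => // _; apply: dgraph0. Qed.

Lemma poly_graph1 : poly_graph 1 0.
Proof. exact: poly_graphC (dgraph1 gG). Qed.

Lemma poly_graphX : poly_graph 'X 0.
Proof.
move=> i; rewrite coefX coef0; case: eqP => _; last exact: dgraph0.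
exact: dgraph1 gG.
Qed.

Lemma poly_graphB P P1 Q Q1 :
  poly_graph P P1 -> poly_graph Q Q1 -> poly_graph (P - Q) (P1 - Q1).
Proof. by move=> hP hQ i; rewrite !coefB; apply: dgraphB. Qed.

Lemma poly_graphM P P1 Q Q1 :
  poly_graph P P1 -> poly_graph Q Q1 -> poly_graph (P * Q) (P1 * Q + P * Q1).
Proof.
move=> hP hQ i; rewrite coefD !coefM -big_split /=.
apply: (big_ind2 (fun x y => G (x, y))) => [||j _]; first exact: dgraph0.
  by move=> *; apply: dgraphD.
exact: dgraphM.
Qed.

Lemma poly_graphXn n : poly_graph 'X^n 0.
Proof.
elim: n => [|n IH]; first exact: poly_graph1.
have := poly_graphM poly_graphX IH.
by rewrite exprS mulr0 mul0r addr0.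
Qed.

Lemma poly_graph_deriv P P1 : poly_graph P P1 -> poly_graph P^`() P1^`().
Proof.
move=> hP i; rewrite !coef_deriv.
elim: i.+1 {1 3}i.+1 => [|n IH] j; first by rewrite !mulr0n; apply: dgraph0.
by rewrite !mulrS; apply: dgraphD; last apply: IH.
Qed.

Lemma poly_graph_fun P1 : poly_graph 0 P1 -> P1 = 0.
Proof.
move=> h; apply/polyP => i; rewrite coef0; apply: (dgraph_fun gG).
by have := h i; rewrite coef0.
Qed.

(* If [a] is algebraic over the domain of the derivation, with minimal
   polynomial [m], then [b = D a] is forced: [m^D(a) + m'(a) b = 0]. *)
Lemma dgraph_extend a : exists b,
  forall P P1, poly_graph P P1 -> P.[a] = 0 -> dual_eval a b P P1 = 0.
Proof.
pose alg n := exists P P1, [/\ poly_graph P P1, P.[a] = 0, P != 0 & size P = n].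
have [[n0 alg_n0]|tr] := pselect (exists n, alg n); last first.
  (* Here [a] is transcendental over the domain of [G]: only [P = 0] is concerned, and any [b] would
     do. *)
  exists 0 => P P1 hP Pa0; have P0 : P = 0.
    apply/eqP; apply: contrapT => /negP P0; apply: tr.
    by exists (size P), P, P1.
  move: hP; rewrite P0 => /poly_graph_fun ->.
  by rewrite /dual_eval derivC !hornerE.
have exn : exists n, `[< alg n >] by exists n0; apply/asboolP.
case: (ex_minnP exn) => n /asboolP [m0 [m01 [hm0 m0a m00 sz_m0]]] min_n.
have {}min_n P P1 : poly_graph P P1 -> P.[a] = 0 -> P != 0 -> (n <= size P)%N.
  by move=> hP Pa P0; apply: min_n; apply/asboolP; exists P, P1.
pose c := (lead_coef m0)^-1.
have c0 : c != 0 by rewrite invr_eq0 lead_coef_eq0.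
have [c1 hc] : exists c1, G (c, c1).
  exists (- m01`_(size m0).-1 / lead_coef m0 ^+ 2).
  by apply: (dgraphV gG); [rewrite lead_coef_eq0 | apply: hm0].
pose m := c%:P * m0; pose m1 := c1%:P * m0 + c%:P * m01.
have hm : poly_graph m m1 by apply: poly_graphM => //; apply: poly_graphC.
have ma : m.[a] = 0 by rewrite !hornerE m0a mulr0.
have sz_m : size m = n by rewrite size_Cmul.
have m_monic : lead_coef m = 1.
  by rewrite lead_coefM lead_coefC mulVf // lead_coef_eq0.
have m_neq0 : m != 0 by rewrite -lead_coef_eq0 m_monic oner_neq0.
have n_gt1 : (1 < n)%N.
  rewrite -sz_m ltnNge; apply/negP => /size1_polyC mC.
  move: ma m_neq0; rewrite mC hornerC => ->.
  by rewrite eqxx.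
(* Characteristic 0: the top coefficient of [m'] is the degree [n - 1] of the monic [m], hence
   nonzero. By minimality of [n], [m'] then cannot vanish at [a]. *)
have dm0 : m^`() != 0.
  apply/eqP => /(congr1 (fun p : {poly E} => p`_n.-2)) /eqP; apply/negP.
  have nE : n.-2.+1 = (size m).-1 by rewrite sz_m; case: (n) n_gt1 => [|[]].
  by rewrite coef0 coef_deriv nE -lead_coefE m_monic -nE ((pcharf0P E).1 charE).
have dma : m^`().[a] != 0.
  apply/eqP => dma; have := min_n _ _ (poly_graph_deriv hm) dma dm0.
  by rewrite -sz_m leqNgt lt_size_deriv.
exists (- m1.[a] / m^`().[a]).
have m_dual : dual_eval a (- m1.[a] / m^`().[a]) m m1 = 0.
  by rewrite /dual_eval; field.
move=> P; move: {2}(size P) (leqnn (size P)) => s.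
elim: s P => [|s IH] P sP P1 hP Pa.
  move: sP hP; rewrite leqn0 size_poly_eq0 => /eqP -> /poly_graph_fun ->.
  by rewrite /dual_eval derivC !hornerE.
have [P0|P0] := eqVneq P 0.
  move: hP; rewrite P0 => /poly_graph_fun ->.
  by rewrite /dual_eval derivC !hornerE.
have nP := min_n _ _ hP Pa P0.
(* One step of Euclidean division: [e * m] cancels the leading term of [P], [e1] is the derivative
   of [e], and the dual value of [e * m] is 0 because [m(a)] and the dual value of [m] are. *)
pose e := (lead_coef P)%:P * 'X^(size P - n).
pose e1 := (P1`_(size P).-1)%:P * 'X^(size P - n) + (lead_coef P)%:P * 0.
have he : poly_graph e e1.
  by apply: poly_graphM (poly_graphXn _); apply: poly_graphC; apply: hP.
have hR := poly_graphB hP (poly_graphM he hm).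
have Ra : (P - e * m).[a] = 0 by rewrite hornerD hornerN hornerM Pa ma mulr0 subrr.
have sR : (size (P - e * m)%R <= s)%N.
  apply/leq_sizeP => j sj; rewrite coefB -mulrA coefCM coefXnM.
  have Pj : (size P <= j.+1)%N by apply: leq_trans sP _.
  have szP0 : (0 < size P)%N by rewrite size_poly_gt0.
  case: ltnP => jlt.
    exfalso; have : (j.+1 <= size P - n)%N by [].
    rewrite leqNgt; case/negP; apply: leq_trans Pj.
    by rewrite -[ltnRHS]subn0 ltn_sub2l // ltnW.
  have -> : m`_(j - (size P - n)) = (j.+1 == size P)%:R.
    case: (ltngtP j.+1 (size P)) Pj => // Pj _.
      rewrite nth_default // sz_m leq_subRL // subnK //.
    rewrite -m_monic lead_coefE sz_m; congr (_`_ _).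
    move: nP; rewrite -Pj; case: (n) n_gt1 => // n' _.
    by rewrite ltnS subSS => /subKn.
  case: eqP => [jE|jN]; first by rewrite mulr1 lead_coefE -jE subrr.
  rewrite mulr0 subr0 nth_default // -ltnS ltn_neqAle Pj andbT eq_sym.
  exact/eqP.
have := IH _ sR _ hR Ra.
by rewrite dual_evalB dual_evalM ma m_dual !mulr0 addr0 subr0.
Qed.

End Extension.

Section Criterion.
Hypothesis charE : [pchar E] =i pred0.
Variables (R : comNzRingType) (phi : {rmorphism R -> E}) (a : E).

(* A maximal derivation graph extending [d/da] on [phi(R)(a)] is total. *)
Lemma algebraic_or_derivation :
  (exists p : {poly R}, map_poly phi p != 0 /\ root (map_poly phi p) a) \/
  (exists D : E -> E, [/\ derivation D, forall r, D (phi r) = 0 & D a = 1]).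
Proof.
have [alg|tr] := pselect (exists p : {poly R}, map_poly phi p != 0 /\
  root (map_poly phi p) a); [by left | right].
(* Coefficients in [phi(R)] are constants, hence [P1 = 0]; [b = 1] gives [d/da]. *)
pose PP P P1 := P1 = 0 /\ exists p : {poly R}, P = map_poly phi p.
pose G1 := frac_graph PP a 1.
have PP1 : PP 1 0 by split=> //; exists 1; rewrite rmorph1.
have PPB P P1 Q Q1 : PP P P1 -> PP Q Q1 -> PP (P - Q) (P1 - Q1).
  move=> [-> [p ->]] [-> [q ->]]; split; first by rewrite subrr.
  by exists (p - q); rewrite rmorphB.
have PPM P P1 Q Q1 : PP P P1 -> PP Q Q1 -> PP (P * Q) (P1 * Q + P * Q1).
  move=> [-> [p ->]] [-> [q ->]]; split; first by rewrite mul0r mulr0 addr0.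
  by exists (p * q); rewrite rmorphM.
have PPfun P P1 : PP P P1 -> P.[a] = 0 -> dual_eval a 1 P P1 = 0.
  move=> [-> [p ->]] pa; have -> : map_poly phi p = 0.
    apply/eqP; apply: contrapT => /negP p0; apply: tr; exists p; split=> //.
    exact/rootP.
  by rewrite /dual_eval derivC !hornerE.
have gG1 : dgraph G1 by apply: frac_graph_dgraph.
pose good (G : set (E * E)) := G = set0 \/ dgraph G /\ (G1 `<=` G)%classic.
have [A [gA maxA]] : exists A, good A /\ forall B, (A `<` B)%classic -> ~ good B.
  apply: Zorn_bigcup => F goodF totF.
  have [[X0 [FX0 X0_neq0]]|F0] := pselect (exists X, F X /\ X <> set0); last first.
    left; rewrite -subset0 => xy [X FX Xxy]; have [] := F0.
    by exists X; split=> // XE; rewrite XE in Xxy.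
  have goodX X xy : F X -> X xy -> dgraph X /\ (G1 `<=` X)%classic.
    by move=> FX Xxy; case: (goodF _ FX) => // XE; rewrite XE in Xxy.
  have gX0 : dgraph X0 /\ (G1 `<=` X0)%classic by case: (goodF _ FX0).
  have two xy zt : (\bigcup_(X in F) X)%classic xy ->
      (\bigcup_(X in F) X)%classic zt -> exists X, [/\ F X, X xy & X zt].
    move=> [X FX Xxy] [Y FY Yzt]; case: (totF _ _ FX FY) => sub.
      by exists Y; split=> //; apply: sub.
    by exists X; split=> //; apply: sub.
  right; split; last by move=> xy G1xy; exists X0 => //; apply: gX0.2.
  split.
  - by exists X0 => //; apply: dgraph1 gX0.1.
  - move=> x y x' y' h h'; have [X [FX Xx Xx']] := two _ _ h h'.
    by exists X => //; apply: dgraphB (goodX _ _ FX Xx).1 _ _ _ _ Xx Xx'.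
  - move=> x y x' y' h h'; have [X [FX Xx Xx']] := two _ _ h h'.
    by exists X => //; apply: dgraphM (goodX _ _ FX Xx).1 _ _ _ _ Xx Xx'.
  - move=> x y x0 [X FX Xxy]; exists X => //.
    exact: dgraphV (goodX _ _ FX Xxy).1 _ _ x0 Xxy.
  - move=> y [X FX Xxy]; exact: dgraph_fun (goodX _ _ FX Xxy).1 _ Xxy.
have [dA G1A] : dgraph A /\ (G1 `<=` A)%classic.
  case: gA => // A0; case: (maxA G1); last by right; split.
  by rewrite A0 properEneq; split=> //; apply/eqP => G10; move: (dgraph1 gG1); rewrite -G10.
(* Adjoining [x] gives a graph containing [A]; by maximality it is [A] itself. *)
have totA x : exists y, A (x, y).
  have [b hb] := dgraph_extend charE dA x.
  pose B := frac_graph (poly_graph A) x b.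
  have hB : dgraph B.
    apply: frac_graph_dgraph hb; first exact: poly_graph1.
      by move=> *; apply: poly_graphB.
    by move=> *; apply: poly_graphM.
  have AB : (A `<=` B)%classic.
    move=> [z w] Azw; have := frac_graph_poly x b (poly_graph1 dA) (poly_graphC dA Azw).
    by rewrite /dual_eval derivC !hornerE.
  have Bx : B (x, b).
    have := frac_graph_poly x b (poly_graph1 dA) (poly_graphX dA).
    by rewrite /dual_eval derivX !hornerE.
  exists b; apply: contrapT => NAx; apply: (maxA B); last first.
    by right; split=> //; apply: subset_trans AB.
  by rewrite properEneq; split=> //; apply/eqP => ABE; apply: NAx; rewrite ABE.
pose D x := projT1 (cid (totA x)).
have DP x : A (x, D x) by rewrite /D; case: cid.
have Duniq x y : A (x, y) -> D x = y.
  move=> Axy; apply/eqP; rewrite -subr_eq0; apply/eqP/(dgraph_fun dA).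
  by rewrite -(subrr x); apply: dgraphB.
exists D; split.
- by split=> x y; apply: Duniq; [apply: dgraphD | apply: dgraphM].
- move=> r; apply: Duniq; apply: G1A.
  have := @frac_graph_poly PP a 1 PP1 (phi r)%:P 0.
  rewrite /dual_eval derivC !hornerE; apply; split=> //.
  by exists r%:P; rewrite map_polyC.
- apply: Duniq; apply: G1A.
  have := @frac_graph_poly PP a 1 PP1 'X 0.
  rewrite /dual_eval derivX !hornerE; apply; split=> //.
  by exists 'X; rewrite map_polyX.
Qed.

End Criterion.
End DerivationGraphs.

(** * Weierstrass division in K[[t]][[v]] *)

Section Weierstrass.
Variable k : comNzRingType.
Local Notation A := (ps (ps k)).
Implicit Types x y z : A.

(** Elements of [A] are series in v over [k[[t]]], and [tau] is t as a constant in v. *)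
Definition tau : A := pC (pX k).

Lemma tauXnM N x i n :
  (tau ^+ N * x) i n = if (n < N)%N then 0 else x i (n - N)%N.
Proof. by rewrite /tau -rmorphXn pCM pXnM. Qed.

Lemma tauM x i n : (tau * x) i n = if n is m.+1 then x i m else 0.
Proof. by rewrite -[tau]expr1 tauXnM; case: n => // n; rewrite subn1. Qed.

Definition tau_dvd N x := forall i n, (n < N)%N -> x i n = 0.

Lemma tau_dvdP N x : tau_dvd N x <-> exists z, x = tau ^+ N * z.
Proof.
split=> [xN|[z ->] i n nN]; last by rewrite tauXnM nN.
exists (PS (fun i => PS (fun n => x i (n + N)%N))).
apply: psP => i; apply: psP => n; rewrite tauXnM; case: ltnP => [/xN//|Nn] /=.
by rewrite subnK.
Qed.

Lemma tau_dvdB N x y : tau_dvd N x -> tau_dvd N y -> tau_dvd N (x - y).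
Proof. by move=> xN yN i n nN; rewrite !psB xN // yN // subrr. Qed.

Lemma tau_dvd0 N : tau_dvd N 0.
Proof. by move=> i n _; rewrite !ps0. Qed.

Lemma tau_dvdD N x y : tau_dvd N x -> tau_dvd N y -> tau_dvd N (x + y).
Proof. by move=> xN yN i n nN; rewrite !psD xN // yN // addr0. Qed.

Lemma tau_dvdMl N x y : tau_dvd N x -> tau_dvd N (y * x).
Proof. by move=> /tau_dvdP[z ->]; apply/tau_dvdP; exists (y * z); rewrite mulrCA. Qed.

Lemma tau_dvdS N x : tau_dvd N x -> tau_dvd N.+1 (tau * x).
Proof. by move=> /tau_dvdP[z ->]; apply/tau_dvdP; exists z; rewrite exprS mulrA. Qed.

Lemma tau_dvd_shift j N x : tau_dvd N x -> tau_dvd N (iter j (@pshift _) x).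
Proof. by move=> xN i n nN; rewrite iter_pshift xN. Qed.

Lemma tau_dvd_eq0 x : (forall N, tau_dvd N x) -> x = 0.
Proof. by move=> x0; apply: psP => i; apply: psP => n; rewrite (x0 n.+1). Qed.

(** [T] preserves divisibility by powers of t, so [x -> a + tau * T x] is a t-adic contraction and
    its iterates from 0 converge. *)
Lemma tau_contraction (T : A -> A) (a : A) :
  (forall x y, T (x - y) = T x - T y) -> (forall x, T (tau * x) = tau * T x) ->
  exists q, q = a + tau * T q.
Proof.
move=> TB Ttau.
have TN N x : tau_dvd N x -> tau_dvd N (T x).
  move=> /tau_dvdP[z ->]; apply/tau_dvdP; exists (T z).
  elim: N => [|N IH]; first by rewrite !expr0 !mul1r.
  by rewrite !exprS -!mulrA Ttau IH.
pose s N := iter N (fun x => a + tau * T x) 0.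
have sS N : s N.+1 = a + tau * T (s N) by [].
have ds N : tau_dvd N (s N.+1 - s N).
  elim: N => [|N IH]; first by move=> i n.
  have -> : s N.+2 - s N.+1 = tau * T (s N.+1 - s N).
    have sB x y : (a + tau * T x) - (a + tau * T y) = tau * T (x - y).
      by rewrite TB; ring.
    exact: sB.
  exact/tau_dvdS/TN/IH.
have ds2 N M : (N <= M)%N -> tau_dvd N (s M - s N).
  move/subnK => <-; elim: (M - N)%N => [|m IH].
    by rewrite add0n subrr; apply: tau_dvd0.
  rewrite addSn -(subrK (s (m + N)%N) (s _.+1)) -addrA; apply: tau_dvdD => //.
  by move=> i n nN; apply: ds; apply: leq_trans nN (leq_addl _ _).
(* The coefficient of [t^n] no longer changes from the iterate [n + 1] on. *)
pose q : A := PS (fun i => PS (fun n => s n.+1 i n)).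
have qs N : tau_dvd N (q - s N).
  move=> i n nN; rewrite !psB /=; apply/eqP; rewrite -oppr_eq0 opprB.
  by have := ds2 _ _ nN i n (ltnSn n); rewrite !psB => ->.
exists q; apply/eqP; rewrite -subr_eq0; apply/eqP/tau_dvd_eq0 => N.
have -> : q - (a + tau * T q) = (q - s N.+1) - tau * T (q - s N).
  by rewrite sS TB; ring.
apply: tau_dvdB; first by move=> i n nN; apply: qs; apply: ltnW.
by move=> i n nN; apply: tau_dvdS (TN _ _ (qs N)) _ _ _; apply: ltnW.
Qed.

Section Division.
Variables (n : nat) (B B' e e' : A).
Hypothesis BE : B = pX _ ^+ n * e + tau * B'.
Hypothesis e'e : e' * e = 1.

(** Modulo t, [B] is [v^n] times the unit [e]. The remainder has no term from [v^n] on exactly when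
    [e * q] is the shift by [n] of [f - tau * (B' * q)], a fixed-point equation for [q]. *)
Lemma weierstrass_division (f : A) :
  exists q, f - B * q = plow n (f - tau * (B' * q)).
Proof.
pose sh := iter n (@pshift (ps k)).
have [||q qE] := @tau_contraction (fun x => - (e' * sh (B' * x))) (e' * sh f).
- by move=> x y; rewrite mulrBr /sh iter_pshiftB; ring.
- by move=> x; rewrite [B' * _]mulrCA /sh iter_pshift_CM; ring.
exists q; have {}qE : e * q = sh (f - tau * (B' * q)).
  have shE : sh (f - tau * (B' * q)) = sh f - tau * sh (B' * q).
    by rewrite /sh iter_pshiftB iter_pshift_CM.
  by rewrite {1}qE shE -[RHS]mul1r -e'e; ring.
have := plow_shift n (f - tau * (B' * q)); rewrite -/sh -qE => /(canLR (addrK _)) <-.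
by rewrite BE; ring.
Qed.

(** Divide [v^n] by [B]: the remainder is a multiple of t, since [v^n] has no coefficient below
    [n]. *)
Lemma weierstrass_preparation :
  exists q W', ps_vanish n W' /\ pX _ ^+ n + tau * W' = B * q.
Proof.
have [q qE] := weierstrass_division (pX _ ^+ n).
exists q, (plow n (B' * q)); split; first by move=> i ni /=; rewrite ltnNge ni.
have -> : B * q = pX _ ^+ n - plow n (pX _ ^+ n - tau * (B' * q)) by rewrite -qE; ring.
apply: psP => i; rewrite psB psD pCM !plowE.
case: ltnP => ni; first by rewrite psB pCM subKr pXn ltn_eqF // add0r.
by rewrite mulr0 subr0 addr0.
Qed.

(** The square of the Weierstrass polynomial is again a power of v modulo t; the bound on [U'] keeps
    its degree in v at most [2n], as [ispoly_quotient] requires. *)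
Lemma weierstrass_polynomial : exists W w U' : A,
  [/\ ps_ispoly W, W != 0, W = B * w, ps_vanish (n + n).+1 U' &
      W ^+ 2 = pX _ ^+ (n + n) + tau * U'].
Proof.
have [w [W' [W'0 WE]]] := weierstrass_preparation.
exists (pX _ ^+ n + tau * W'), w, (pX _ ^+ n * (W' + W') + tau * W' ^+ 2); split=> //.
- by apply: ispolyD (ispolyX _ _) (ispolyM (ispolyC _) _); exists n.
- apply/eqP => /(congr1 (fun x : A => x n 0%N)) /eqP.
  by rewrite !psD pXn eqxx tauM addr0 oner_eq0.
- move=> i ni; rewrite psD pXnM pCM ltnNge (leq_trans _ (ltnW ni)) ?leq_addr // [~~ _]/=.
  rewrite psD W'0 ?leq_subRL ?(leq_trans _ (ltnW ni)) ?leq_addr // ?ltnW //.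
  by rewrite expr2 (ps_vanishM W'0 W'0) ?mulr0 ?addr0 // ltnW.
- by rewrite exprD; ring.
Qed.

End Division.

(** [v^K V] is still a power of v modulo t, so division by it leaves a remainder polynomial in v,
    which agrees with [f] in the first [K] coefficients. *)
Lemma weierstrass_remainder (n K : nat) (V U' f : A) : V = pX _ ^+ n + tau * U' ->
  exists g s, ps_ispoly g /\ f - g = pX _ ^+ K * (V * s).
Proof.
move=> VE; have VE' : pX _ ^+ K * V = pX _ ^+ (K + n) * 1 + tau * (pX _ ^+ K * U').
  by rewrite VE exprD mulr1 mulrDr [in RHS]mulrCA.
have [s sE] := weierstrass_division VE' (mul1r 1) f.
exists (f - pX _ ^+ K * V * s), s; split; first by rewrite sE; apply: ispoly_low.
by rewrite subKr mulrA.
Qed.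

(** The divisor has degree [m] in v and its leading coefficient is 1 modulo t. *)
Lemma ispoly_quotient m (U' s : A) : ps_vanish m.+1 U' ->
  ps_ispoly ((pX _ ^+ m + tau * U') * s) -> ps_ispoly s.
Proof.
move=> U'0 [M pM]; exists M => i Mi; apply: psP => n; rewrite ps0.
(* Induction on the order in t: the coefficient of [v^(j + m)] expresses [s j] as t times a
   combination of coefficients of [s] of index at least [j]. *)
suff H N : forall j l, (M <= j)%N -> (l < N)%N -> s j l = 0 by apply: (H n.+1).
elim: N => [//|N IH] j l Mj lN.
have := pM (j + m)%N (leq_trans Mj (leq_addr _ _)).
rewrite mulrDl -mulrA psD pXnM ltnNge leq_addl addnK [~~ true]/=.
move=> /(congr1 (fun x : ps k => x l)); rewrite psD tauM ps0.
suff -> : (if l is l'.+1 then (U' * s) (j + m)%N l' else 0) = 0 by rewrite addr0.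
case: l lN => // l; rewrite ltnS => lN.
rewrite psM ps_sum big1 // => a _; have am := ltn_ord a.
case: (ltnP m a) => [/U'0->|ma]; first by rewrite mul0r.
rewrite psM big1 // => b _; rewrite [X in _ * X]IH ?mulr0 //.
  by rewrite -addnBA // (leq_trans Mj) ?leq_addr.
exact: leq_ltn_trans (leq_subr _ _) lN.
Qed.

End Weierstrass.

(** * Polynomial expressions and their partial derivatives *)

Inductive pexp (C : Type) (N : nat) : Type :=
  | PCst of C | PNat of nat | PVar of 'I_N
  | PAdd of pexp C N & pexp C N | PMul of pexp C N & pexp C N.

Arguments PNat {C N}.

Section PolynomialExpressions.
Variables (C : Type) (N : nat).

(** [phi] is any map, so one expression can be evaluated in K(u)[[t]], in series in v and over
    fraction fields. *)
Fixpoint pval (A : comNzRingType) (phi : C -> A) (y : 'I_N -> A) (e : pexp C N) : A :=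
  match e with
  | PCst c => phi c
  | PNat n => n%:R
  | PVar i => y i
  | PAdd e1 e2 => pval phi y e1 + pval phi y e2
  | PMul e1 e2 => pval phi y e1 * pval phi y e2
  end.

Fixpoint pdif (A : comNzRingType) (phi : C -> A) (y : 'I_N -> A) (j : 'I_N)
    (e : pexp C N) : A :=
  match e with
  | PCst _ | PNat _ => 0
  | PVar i => (i == j)%:R
  | PAdd e1 e2 => pdif phi y j e1 + pdif phi y j e2
  | PMul e1 e2 => pdif phi y j e1 * pval phi y e2 + pval phi y e1 * pdif phi y j e2
  end.

Lemma pval_derivation (A : comNzRingType) (phi : C -> A) (y : 'I_N -> A) e
    (D : A -> A) : derivation D -> (forall c, D (phi c) = 0) ->
  D (pval phi y e) = \sum_j pdif phi y j e * D (y j).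
Proof.
move=> derD Dphi; elim: e => [c|n|i|e1 IH1 e2 IH2|e1 IH1 e2 IH2] /=.
- by rewrite Dphi big1 // => j _; rewrite mul0r.
- by rewrite derD_nat // big1 // => j _; rewrite mul0r.
- rewrite (bigD1 i) //= eqxx mul1r big1 ?addr0 // => j /negPf ij.
  by rewrite eq_sym ij mul0r.
- by rewrite derD.1 IH1 IH2 -big_split; apply: eq_bigr => j _; rewrite mulrDl.
- rewrite derD.2 IH1 IH2 mulr_suml mulr_sumr -big_split.
  by apply: eq_bigr => j _ /=; ring.
Qed.

Lemma pval_morph (A A' : comNzRingType) (h : {rmorphism A -> A'}) (phi : C -> A)
    (y : 'I_N -> A) e :
  h (pval phi y e) = pval (fun c => h (phi c)) (fun j => h (y j)) e.
Proof.
by elim: e => [c|n|i|e1 IH1 e2 IH2|e1 IH1 e2 IH2] //=;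
  rewrite ?rmorph_nat ?rmorphD ?rmorphM ?IH1 ?IH2.
Qed.

Lemma pdif_morph (A A' : comNzRingType) (h : {rmorphism A -> A'}) (phi : C -> A)
    (y : 'I_N -> A) j e :
  h (pdif phi y j e) = pdif (fun c => h (phi c)) (fun j => h (y j)) j e.
Proof.
elim: e => [c|n|i|e1 IH1 e2 IH2|e1 IH1 e2 IH2] //=;
  rewrite ?rmorph0 ?rmorph_nat ?rmorphD ?IH1 ?IH2 //.
by rewrite !rmorphM !pval_morph IH1 IH2.
Qed.

Section Congruence.
Variables (A : comNzRingType) (phi : C -> A) (y y' : 'I_N -> A) (w : A).
Hypothesis yy' : forall j, exists z, y j - y' j = w * z.

Lemma pval_cong e : exists z, pval phi y e - pval phi y' e = w * z.
Proof.
elim: e => [c|n|i|e1 [z1 IH1] e2 [z2 IH2]|e1 [z1 IH1] e2 [z2 IH2]] /=.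
- by exists 0; rewrite subrr mulr0.
- by exists 0; rewrite subrr mulr0.
- exact: yy'.
- by exists (z1 + z2); rewrite mulrDr -IH1 -IH2; ring.
- exists (z1 * pval phi y e2 + pval phi y' e1 * z2).
  by rewrite mulrDr mulrA [w * (_ * z2)]mulrCA -IH1 -IH2; ring.
Qed.

Lemma pdif_cong j e : exists z, pdif phi y j e - pdif phi y' j e = w * z.
Proof.
elim: e => [c|n|i|e1 [z1 IH1] e2 [z2 IH2]|e1 [z1 IH1] e2 [z2 IH2]] /=;
  try by exists 0; rewrite subrr mulr0.
- by exists (z1 + z2); rewrite mulrDr -IH1 -IH2; ring.
- have [x1 h1] := pval_cong e1; have [x2 h2] := pval_cong e2.
  exists (z1 * pval phi y e2 + pdif phi y' j e1 * x2 +
          x1 * pdif phi y j e2 + pval phi y' e1 * z2).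
  have -> : forall a b c d : A, w * (z1 * a + b * x2 + x1 * c + d * z2) =
    (w * z1) * a + b * (w * x2) + (w * x1) * c + d * (w * z2) by move=> *; ring.
  by rewrite -IH1 -IH2 -h1 -h2; ring.
Qed.

End Congruence.

Lemma pval_ispoly (R : comNzRingType) (phi : C -> ps R) (y : 'I_N -> ps R) e :
  (forall c, ps_ispoly (phi c)) -> (forall j, ps_ispoly (y j)) ->
  ps_ispoly (pval phi y e).
Proof.
move=> hphi hy; elim: e => //= [n|e1 IH1 e2 IH2|e1 IH1 e2 IH2].
- by rewrite -(rmorph_nat (@pC R)); apply: ispolyC.
- exact: ispolyD.
- exact: ispolyM.
Qed.

End PolynomialExpressions.

Section CoefficientwiseDerivation.
Variables (E : comNzRingType) (D : E -> E).
Hypothesis derD : derivation D.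

(** The extension of [D] to series in v for which v is a constant. *)
Definition cder (f : ps E) : ps E := PS (fun n => D (f n)).

Lemma cder_derivation : derivation cder.
Proof.
split=> f g; apply: psP => n; first by rewrite /= derD.1.
rewrite psD !psM /= (derD_sum derD) -big_split.
by apply: eq_bigr => i _; rewrite derD.2.
Qed.

Lemma cder_shift j f : cder (iter j (@pshift E) f) = iter j (@pshift E) (cder f).
Proof. by apply: psP => n; rewrite /= !iter_pshift. Qed.

Lemma ispoly_cder f : ps_ispoly f -> ps_ispoly (cder f).
Proof. by move=> [M fM]; exists M => i Mi /=; rewrite fM // derD0. Qed.

End CoefficientwiseDerivation.

Lemma fraction_repr (S : idomainType) (x : {fraction S}) :
  exists a b : S, b != 0 /\ x = FracField.tofrac a / FracField.tofrac b.
Proof.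
elim/quotW: x => r; exists (frac r).1, (frac r).2; split; first exact: denom_ratioP.
apply: (canRL (mulfK _)); first by rewrite tofrac_eq0 denom_ratioP.
unlock FracField.tofrac; rewrite -[LHS]FracField.pi_mul; apply/eqmodP.
rewrite /= FracField.equivfE /FracField.mulf !numden_Ratio ?mulr1 ?oner_eq0 ?denom_ratioP //.
by rewrite mulrC.
Qed.

(** * The linearized equation *)

Section CommonDenominators.
Variable S : idomainType.
Local Notation E := {fraction S}.
Local Notation frac := (@FracField.tofrac S).
Implicit Types g : ps E.

(** The coefficients of a series in v over the fraction field may have unbounded poles in t. A
    common denominator brings the series back over [S], where orders in t can be compared. *)
Definition common_denom g :=
  exists c : S, c != 0 /\ exists h : ps S, pC (frac c) * g = ps_map frac h.

Lemma common_denomI (h : ps S) : common_denom (ps_map frac h).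
Proof. by exists 1; rewrite oner_eq0; split=> //; exists h; rewrite !rmorph1 mul1r. Qed.

Lemma common_denomC x : common_denom (pC x).
Proof.
have [a [b [b0 ->]]] := fraction_repr x; exists b; split=> //; exists (pC a).
by rewrite -rmorphM mulrC divfK ?tofrac_eq0 // ps_mapC.
Qed.

Lemma common_denomM f g : common_denom f -> common_denom g -> common_denom (f * g).
Proof.
move=> [a [a0 [h ah]]] [b [b0 [h' bh']]]; exists (a * b).
split; first by rewrite mulf_neq0.
by exists (h * h'); rewrite !rmorphM /= -ah -bh'; ring.
Qed.

Lemma common_denomD f g : common_denom f -> common_denom g -> common_denom (f + g).
Proof.
move=> [a [a0 [h ah]]] [b [b0 [h' bh']]]; exists (a * b).
split; first by rewrite mulf_neq0.
exists (pC b * h + pC a * h').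
by rewrite !(rmorphD, rmorphM) /= -ah -bh' !ps_mapC; ring.
Qed.

Lemma common_denomN g : common_denom g -> common_denom (- g).
Proof.
by move=> [c [c0 [h ch]]]; exists c; split=> //; exists (- h); rewrite rmorphN /= -ch mulrN.
Qed.

Lemma common_denom_sum (I : Type) (r : seq I) (F : I -> ps E) :
  (forall i, common_denom (F i)) -> common_denom (\sum_(i <- r) F i).
Proof.
move=> hF; elim: r => [|i r IH]; last by rewrite big_cons; apply: common_denomD.
by rewrite big_nil -(rmorph0 (ps_map frac)); apply: common_denomI.
Qed.

Lemma common_denom_ispoly g : ps_ispoly g -> common_denom g.
Proof.
move=> [M gM]; elim: M g gM => [|M IH] g gM.
  have -> : g = ps_map frac 0 by apply: psP => n; rewrite rmorph0 gM.
  exact: common_denomI.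
rewrite (pX_shift g) -(ps_mapX frac); apply: common_denomD (common_denomC _) _.
by apply: common_denomM (common_denomI _) (IH _ _) => i Mi; apply: gM.
Qed.

End CommonDenominators.

Section LinearizedEquation.
Variable k : idomainType.
Local Notation S := (ps k).
Local Notation A := (ps S).
Local Notation E := {fraction S}.
Local Notation frac := (@FracField.tofrac S).
Local Notation iota := (ps_map frac).
Local Notation shift j := (iter j (@pshift _)).

Lemma frac_inj : injective frac.
Proof. by move=> x y /eqP; rewrite tofrac_eq => /eqP. Qed.

(** If [t^N] divides [h], then [t^(N+1)] divides the right-hand side, and also [h] once [v^r] is
    removed by a shift and [d1] by its inverse. *)
Lemma linear_unique (r K : nat) (d1 d1' h : A) (q : 'I_K.+1 -> A) :
  d1' * d1 = 1 ->
  pX _ ^+ r * d1 * h = tau k * \sum_j q j * shift j h -> h = 0.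
Proof.
move=> d1'd1 hE; apply: tau_dvd_eq0; elim=> [|N IH]; first by move=> i n.
have : tau_dvd N.+1 (pX _ ^+ r * (d1 * h)).
  rewrite mulrA hE; apply: tau_dvdS.
  elim/big_ind: _ => [||j _]; [exact: tau_dvd0 | exact: tau_dvdD |].
  exact/tau_dvdMl/tau_dvd_shift.
move=> /(@tau_dvd_shift _ r); rewrite iter_pshift_XnM // subnn expr0 mul1r.
by move=> /(@tau_dvdMl _ _ _ d1'); rewrite mulrA d1'd1 mul1r.
Qed.

(** * The derivative of the expanded solution *)

Section Main.
Variables (C : Type) (K r : nat) (phi : C -> A) (e : pexp C K.+1).
Variables (f p0 d d1 d1' : A) (D : E -> E).

Local Notation DD := (cder D).
Local Notation y f := (fun j : 'I_K.+1 => shift j f).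

Hypothesis derD : derivation D.
Hypothesis Dt : D (frac (pX k)) = 0.
Hypothesis phi_poly : forall c, ps_ispoly (phi c).
Hypothesis Dphi : forall c, DD (iota (phi c)) = 0.
Hypothesis p0_poly : ps_ispoly p0.
Hypothesis Dp0 : DD (iota p0) = 0.
Hypothesis d_poly : ps_ispoly d.
Hypothesis Dd : DD (iota d) = 0.
Hypothesis dE : d = pX _ ^+ r * d1.
Hypothesis d1'd1 : d1' * d1 = 1.
Hypothesis fE : d * f = p0 + tau k * pval phi (y f) e.

Let derDD : derivation DD := cder_derivation derD.

Lemma cder_tau : DD (iota (tau k)) = 0.
Proof. by apply: psP => -[|n] //=; rewrite rmorph0 derD0. Qed.

(** The derivative of the defect of [g] in the equation. For [g = f] the defect is 0 and this is the
    linearized equation; it is also applied to the Weierstrass remainder of [f]. *)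
Lemma cder_functional (g : A) :
  DD (iota (d * g - p0 - tau k * pval phi (y g) e)) =
  iota d * DD (iota g) -
  iota (tau k) * \sum_j iota (pdif phi (y g) j e) * shift j (DD (iota g)).
Proof.
rewrite !(derDB derDD, rmorphB) !rmorphM /= !derDD.2 Dd Dp0 cder_tau !mul0r !add0r.
rewrite subr0 pval_morph (pval_derivation _ _ derDD) //; congr (_ - _ * _).
by apply: eq_bigr => j _; rewrite -pdif_morph /= ps_map_shift cder_shift.
Qed.

(* [f] is divided by [W^2 v^K], where the Weierstrass polynomial [W] is a
   multiple of the kernel.  The remainder [g] solves the equation modulo [W^2];
   being a polynomial in [v], its derivative has a common denominator and solves
   the linearized equation modulo [W].  As [f] and [g] agree up to order [K], the
   difference of their derivatives is then divisible by the kernel. *)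
Lemma cder_common_denom : common_denom (DD (iota f)).
Proof.
pose q j := pdif phi (y f) j e.
(* The kernel: the shift by [j] of [v^K Y] is [v^(K - j) Y], so the linear operator sends [v^K Y] to
   [B * Y]. *)
pose B := d * pX _ ^+ K - tau k * \sum_(j < K.+1) q j * pX _ ^+ (K - j).
have BE : B = pX _ ^+ (r + K) * d1 +
    tau k * (- \sum_(j < K.+1) q j * pX _ ^+ (K - j)).
  by rewrite /B dE exprD; ring.
have [W [w [U' [W_poly W_neq0 WE U'0 WW]]]] := weierstrass_polynomial BE d1'd1.
have [g [s [g_poly fgE]]] := weierstrass_remainder K f WW.
have ygE j : exists z, y f j - y g j = W ^+ 2 * z.
  have yE : shift j f - shift j g = shift j (f - g) by rewrite iter_pshiftB.
  exists (pX _ ^+ (K - j) * s); rewrite yE fgE (iter_pshift_XnM _ (leq_ord j)).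
  exact: mulrCA.
pose p := d * g - p0 - tau k * pval phi (y g) e.
have p_poly : ps_ispoly p.
  apply: ispolyB; first by apply: ispolyB => //; apply: ispolyM.
  apply: ispolyM (ispolyC _) (pval_ispoly _ phi_poly _) => j.
  exact: ispoly_shift.
have [z pz] : exists z, p = W ^+ 2 * z.
  have [x xE] := pval_cong phi ygE e.
  exists (tau k * x - d * (pX _ ^+ K * s)).
  have -> : p = tau k * (pval phi (y f) e - pval phi (y g) e) - d * (f - g).
    by rewrite /p (canRL (addrK _) (esym fE)); ring.
  by rewrite xE fgE; ring.
(* Being polynomial in v is what gives the derivative of [z] a common denominator. *)
have z_poly : ps_ispoly z.
  by apply: (ispoly_quotient U'0 (s := z)); rewrite -WW -pz.
pose G := DD (iota f); pose Gg := DD (iota g).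
have FG : iota d * G - iota (tau k) * \sum_j iota (q j) * shift j G = 0.
  rewrite /G -cder_functional fE; set b := pval _ _ _.
  have -> : p0 + tau k * b - p0 - tau k * b = 0 by ring.
  by rewrite rmorph0 derD0.
have [x xE] := choice (fun j => pdif_cong phi ygE j e).
have iota_poly a : ps_ispoly a -> ps_ispoly (iota a).
  by move=> [M aM]; exists M => i Mi /=; rewrite aM // rmorph0.
have den_D a : ps_ispoly a -> common_denom (DD (iota a)).
  by move=> /iota_poly/(ispoly_cder derD)/common_denom_ispoly.
(* The first two terms of [b] come from [D(W^2 z)], with one [W] factored out; the last from
   replacing the partial derivatives at [g] by those at [f], which differ by multiples of [W^2]. *)
have [b den_b FGg] : exists2 b, common_denom b &
    iota d * Gg - iota (tau k) * \sum_j iota (q j) * shift j Gg = iota W * b.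
  exists (2 * DD (iota W) * iota z + iota W * DD (iota z)
     - iota (tau k) * \sum_j iota (W * x j) * shift j Gg).
    apply: common_denomD; first apply: common_denomD.
    - apply: common_denomM (common_denomI _); apply: common_denomM (den_D _ W_poly).
      by rewrite -(rmorph_nat iota); apply: common_denomI.
    - exact: common_denomM (common_denomI _) (den_D _ z_poly).
    - apply/common_denomN/common_denomM; first exact: common_denomI.
      apply: common_denom_sum => j; apply: common_denomM; first exact: common_denomI.
      exact/common_denom_ispoly/ispoly_shift/ispoly_cder/iota_poly.
  have := cder_functional g; rewrite -/p pz rmorphM rmorphXn expr2 /=.
  rewrite !derDD.2 -/Gg => pD.
  have -> : \sum_j iota (q j) * shift j Gg =
      \sum_j iota (pdif phi (y g) j e) * shift j Gg +
      iota W * \sum_j iota (W * x j) * shift j Gg.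
    rewrite mulr_sumr -big_split; apply: eq_bigr => j _ /=.
    rewrite mulrA -rmorphM mulrA -expr2 -xE rmorphB /=; ring.
  rewrite mulrDr opprD addrA -pD; ring.
(* Subtracting the two linear equations gives [B Y = - W b = - B w b]; [B] cancels because [W = B w]
   is nonzero. *)
pose Y := shift K (G - Gg).
have YE : G - Gg = pX _ ^+ K * Y.
  apply: pXn_shift => i iK; rewrite psB /= -(derDB derD) -rmorphB -psB fgE.
  by rewrite pXnM iK rmorph0 derD0.
have BY : iota B * (Y + iota w * b) = 0.
  have : iota d * (G - Gg) - iota (tau k) * \sum_j iota (q j) * shift j (G - Gg) =
      - (iota W * b).
    have -> : \sum_j iota (q j) * shift j (G - Gg) =
      \sum_j iota (q j) * shift j G - \sum_j iota (q j) * shift j Gg.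
      by rewrite -sumrB; apply: eq_bigr => j _; rewrite iter_pshiftB mulrBr.
    rewrite -FGg -[RHS]add0r -[X in _ = X - _]FG !mulrBr; ring.
  rewrite YE; have -> : \sum_j iota (q j) * shift j (pX _ ^+ K * Y) =
      iota (\sum_(j < K.+1) q j * pX _ ^+ (K - j)) * Y.
    rewrite rmorph_sum mulr_suml; apply: eq_bigr => j _.
    by rewrite iter_pshift_XnM ?leq_ord // rmorphM rmorphXn /= ps_mapX mulrA.
  move=> bE; rewrite mulrDr mulrA -rmorphM /= -WE.
  have -> : iota B * Y = iota d * (pX _ ^+ K * Y) -
      iota (tau k) * (iota (\sum_(j < K.+1) q j * pX _ ^+ (K - j)) * Y).
    by rewrite /B rmorphB !rmorphM rmorphXn /= ps_mapX; ring.
  by rewrite bE addNr.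
have B0 : iota B != 0.
  apply: contraNneq W_neq0 => B0; rewrite WE.
  have -> : B = 0 by apply: (ps_map_inj frac_inj); rewrite B0 rmorph0.
  by rewrite mul0r.
move/eqP: BY; rewrite mulf_eq0 (negPf B0) /= addr_eq0 => /eqP YN.
have -> : cder D (iota f) = Gg + pX _ ^+ K * Y by rewrite -YE addrC subrK.
apply: common_denomD; first exact: den_D.
rewrite YN -(ps_mapX frac) -rmorphXn; apply: common_denomM (common_denomI _) _.
by apply/common_denomN/common_denomM => //; apply: common_denomI.
Qed.

(** [h = c D(f)] is a series over [S] that still solves the linear equation, [c] being free of v;
    uniqueness gives [h = 0]. *)
Lemma solution_coef_constant i : D (frac (f i)) = 0.
Proof.
have [c [c0 [h ch]]] := cder_common_denom.
suff h0 : h = 0.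
  have /(congr1 (fun x : ps E => x i)) := ch.
  rewrite h0 rmorph0 pCM ps0 => /eqP.
  by rewrite mulf_eq0 tofrac_eq0 (negPf c0) => /eqP.
apply: (linear_unique (r := r) (q := fun j : 'I_K.+1 => pdif phi (y f) j e) d1'd1).
rewrite -dE; apply: (ps_map_inj frac_inj); rewrite !rmorphM /= -ch mulrCA.
have := cder_functional f; rewrite fE; set b := pval _ _ _.
have -> : p0 + tau k * b - p0 - tau k * b = 0 by ring.
rewrite rmorph0 derD0 // => /esym/eqP; rewrite subr_eq0 => /eqP ->.
rewrite mulrCA; congr (_ * _); rewrite rmorph_sum mulr_sumr; apply: eq_bigr => j _.
by rewrite rmorphM /= ps_map_shift -ch iter_pshift_CM mulrCA.
Qed.

End Main.
End LinearizedEquation.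

(** * Expansion at u = 0 *)

Section Taylor.
Variable K : fieldType.
Implicit Types (f g : ratf K) (p q : {poly K}).
Local Notation frac := (@FracField.tofrac {poly K}).

(** The value picked by [epsilon] comes from some representation of the fraction; cross-multiplying
    and evaluating at 0 shows that all representations agree. *)
Lemma eval0E p q : q.[0] != 0 -> eval0 (frac p / frac q) = p.[0] / q.[0].
Proof.
move=> q0; rewrite /eval0; set P := (fun c => _).
have [p' [q' [q'0 pq ->]]] : P (ClassicalEpsilon.epsilon (inhabits 0) P).
  by apply: ClassicalEpsilon.epsilon_spec; exists (p.[0] / q.[0]), p, q.
have nz r : r.[0] != 0 -> frac r != 0.
  by rewrite tofrac_eq0; apply: contraNneq => ->; rewrite horner0.
move/eqP: pq; rewrite eqr_div ?nz // -!rmorphM tofrac_eq => /eqP /(congr1 (horner^~ 0)).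
by rewrite !hornerM => pq; apply/esym/eqP; rewrite eqr_div // pq.
Qed.

Lemma eval0_poly p : eval0 (frac p) = p.[0].
Proof. by have := @eval0E p 1; rewrite rmorph1 !divr1 hornerC divr1; apply; exact: oner_neq0. Qed.

Lemma nopole0_poly p : nopole0 (frac p).
Proof. by exists p, 1; rewrite hornerC oner_neq0 rmorph1 divr1. Qed.

Lemma frac_eval_neq0 q : q.[0] != 0 -> frac q != 0.
Proof. by rewrite tofrac_eq0; apply: contraNneq => ->; rewrite horner0. Qed.

Lemma eval0D f g : nopole0 f -> nopole0 g ->
  nopole0 (f + g) /\ eval0 (f + g) = eval0 f + eval0 g.
Proof.
move=> [p [q [q0 ->]]] [p' [q' [q'0 ->]]].
have qq0 : (q * q').[0] != 0 by rewrite hornerM mulf_neq0.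
have E : frac p / frac q + frac p' / frac q' = frac (p * q' + p' * q) / frac (q * q').
  by rewrite addf_div ?frac_eval_neq0 // !(rmorphD, rmorphM).
split; first by exists (p * q' + p' * q), (q * q').
by rewrite E !eval0E // !(hornerD, hornerM) addf_div.
Qed.

Lemma eval0M f g : nopole0 f -> nopole0 g ->
  nopole0 (f * g) /\ eval0 (f * g) = eval0 f * eval0 g.
Proof.
move=> [p [q [q0 ->]]] [p' [q' [q'0 ->]]].
have qq0 : (q * q').[0] != 0 by rewrite hornerM mulf_neq0.
have E : frac p / frac q * (frac p' / frac q') = frac (p * p') / frac (q * q').
  by rewrite mulf_div !rmorphM.
split; first by exists (p * p'), (q * q').
by rewrite E !eval0E // !hornerM mulf_div.
Qed.

Definition delta0 f : ratf K := (f - rcst (eval0 f)) / ru K.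

Lemma ru_neq0 : ru K != 0.
Proof. by rewrite tofrac_eq0 polyX_eq0. Qed.

Lemma delta0_poly p c : delta0 (frac (p * 'X + c%:P)) = frac p.
Proof.
rewrite /delta0 eval0_poly hornerD hornerMX mulr0 add0r hornerC /rcst rmorphD addrK.
by rewrite rmorphM mulfK // ru_neq0.
Qed.

(** The numerator [p - c q] vanishes at 0, so the division by u is exact. *)
Lemma nopole0_delta0 f : nopole0 f -> nopole0 (delta0 f).
Proof.
move=> [p [q [q0 fE]]]; pose c := eval0 f.
have /factor_theorem [r rE] : root (p - c%:P * q) 0.
  rewrite /root hornerD hornerN hornerM hornerC /c fE eval0E // divfK //.
  by rewrite subrr.
exists r, q; split=> //; rewrite /delta0 -/c fE.
apply: (mulIf ru_neq0); rewrite divfK ?ru_neq0 //.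
apply: (mulIf (frac_eval_neq0 q0)); rewrite mulrBl divfK ?frac_eval_neq0 //.
rewrite mulrAC divfK ?frac_eval_neq0 // -!rmorphM -rmorphB.
by rewrite rE subr0.
Qed.

(** The Taylor coefficient of order [i] at [u = 0]: [delta0] drops the constant term and shifts the
    expansion. *)
Definition taylor f i := eval0 (iter i delta0 f).

Lemma taylorS f i : taylor f i.+1 = taylor (delta0 f) i.
Proof. by rewrite /taylor iterSr. Qed.

Lemma taylor_poly p i : taylor (frac p) i = p`_i.
Proof.
elim/poly_ind: p i => [|p c IH] [|i].
- by rewrite /taylor eval0_poly horner0 coef0.
- have := delta0_poly 0 0; rewrite mul0r addr0 taylorS => ->.
  elim: i => [|i IH]; first by rewrite /taylor eval0_poly horner0 coef0.
  have := delta0_poly 0 0; rewrite mul0r addr0 taylorS => ->.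
  by rewrite IH !coef0.
- by rewrite /taylor eval0_poly hornerD hornerMX mulr0 hornerC coefD coefMX coefC.
- by rewrite taylorS delta0_poly IH coefD coefMX coefC addr0.
Qed.

Lemma delta0D f g : nopole0 f -> nopole0 g -> delta0 (f + g) = delta0 f + delta0 g.
Proof.
move=> hf hg; rewrite /delta0 (eval0D hf hg).2 /rcst !rmorphD /=.
by rewrite -mulrDl opprD addrACA.
Qed.

(** A twisted Leibniz rule, from [fg - f(0)g(0) = (f - f(0)) g + f(0) (g - g(0))]; iterated, it
    yields the Cauchy product. *)
Lemma delta0M f g : nopole0 f -> nopole0 g ->
  delta0 (f * g) = delta0 f * g + rcst (eval0 f) * delta0 g.
Proof.
move=> hf hg; rewrite /delta0 (eval0M hf hg).2 /rcst !rmorphM /=.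
by rewrite mulrAC mulrA -mulrDl; congr (_ / _); ring.
Qed.

Lemma taylorD f g i : nopole0 f -> nopole0 g ->
  taylor (f + g) i = taylor f i + taylor g i.
Proof.
elim: i f g => [|i IH] f g hf hg; first by rewrite /taylor (eval0D hf hg).2.
by rewrite !taylorS delta0D // IH //; apply: nopole0_delta0.
Qed.

Lemma taylorM f g i : nopole0 f -> nopole0 g ->
  taylor (f * g) i = \sum_(b < i.+1) taylor f b * taylor g (i - b)%N.
Proof.
elim: i f g => [|i IH] f g hf hg.
  by rewrite big_ord1 /taylor (eval0M hf hg).2.
have hc : nopole0 (rcst (eval0 f)) by apply: nopole0_poly.
have hdf := nopole0_delta0 hf; have hdg := nopole0_delta0 hg.
rewrite taylorS delta0M // taylorD; [|exact: (eval0M hdf hg).1|exact: (eval0M hc hdg).1].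
rewrite !IH // [RHS]big_ord_recl addrC; congr (_ + _); last first.
  by apply: eq_bigr => b _; rewrite -taylorS.
(* The expansion of the constant [f(0)] has only its first term. *)
rewrite big_ord_recl big1 ?addr0 => [|b _]; last first.
  by rewrite taylor_poly coefC mul0r.
by rewrite taylor_poly coefC !subn0 -taylorS.
Qed.

End Taylor.

Section Expansion.
Variable K : fieldType.
Local Notation k := (ratf K).
Local Notation frac := (@FracField.tofrac {poly K}).
Implicit Types F G : ps k.

Lemma taylor0 i : taylor (0 : k) i = 0.
Proof. by rewrite -(rmorph0 frac) taylor_poly coef0. Qed.

Lemma nopole0_0 : nopole0 (0 : k).
Proof. by rewrite -(rmorph0 frac); apply: nopole0_poly. Qed.

Lemma taylor_sum (I : Type) (r : seq I) (f : I -> k) i :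
  (forall j, nopole0 (f j)) -> nopole0 (\sum_(j <- r) f j) /\
  taylor (\sum_(j <- r) f j) i = \sum_(j <- r) taylor (f j) i.
Proof.
move=> hf; elim: r => [|j r [IH1 IH2]].
  by rewrite !big_nil taylor0; split=> //; apply: nopole0_0.
rewrite !big_cons taylorD // IH2; split=> //; exact: (eval0D (hf j) IH1).1.
Qed.

Definition regular F := forall n, nopole0 (F n).

Lemma regularD F G : regular F -> regular G -> regular (F + G).
Proof. by move=> hF hG n; rewrite psD; apply: (eval0D (hF n) (hG n)).1. Qed.

Lemma regularM F G : regular F -> regular G -> regular (F * G).
Proof.
move=> hF hG n; rewrite psM.
by apply: (taylor_sum _ 0 _).1 => j; apply: (eval0M (hF _) (hG _)).1.
Qed.

Definition psDelta F : ps k := PS (fun n => delta0 (F n)).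

Lemma regularDelta j F : regular F -> regular (iter j psDelta F).
Proof.
by move=> hF; elim: j => // j IH n; rewrite iterS /=; apply: nopole0_delta0.
Qed.

(* The expansion of [F] at [u = 0], as a power series in a new variable [v]
   over K(u)[[t]]: its coefficients lie in K[[t]]. *)
Definition theta F : ps (ps k) :=
  PS (fun i => PS (fun n => rcst (taylor (F n) i))).

Lemma rcstD (a b : K) : rcst (a + b) = rcst a + rcst b.
Proof. by rewrite /rcst !rmorphD. Qed.

Lemma rcstM (a b : K) : rcst (a * b) = rcst a * rcst b.
Proof. by rewrite /rcst !rmorphM. Qed.

Lemma rcst_sum (I : Type) (r : seq I) (f : I -> K) :
  rcst (\sum_(i <- r) f i) = \sum_(i <- r) rcst (f i).
Proof. by rewrite /rcst !rmorph_sum. Qed.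

Lemma thetaE F i n : theta F i n = rcst (taylor (F n) i).
Proof. by []. Qed.

Lemma thetaD F G : regular F -> regular G -> theta (F + G) = theta F + theta G.
Proof.
move=> hF hG; apply: psP => i; apply: psP => n.
by rewrite /= taylorD // rcstD.
Qed.

Lemma thetaM F G : regular F -> regular G -> theta (F * G) = theta F * theta G.
Proof.
move=> hF hG; apply: psP => i; apply: psP => n; rewrite psM ps_sum.
rewrite thetaE psM (taylor_sum _ i _).2; last first.
  by move=> a; apply: (eval0M (hF _) (hG _)).1.
rewrite rcst_sum; under eq_bigr => a _.
  rewrite taylorM // rcst_sum; under eq_bigr => b _ do rewrite rcstM; over.
by rewrite exchange_big; apply: eq_bigr => b _; rewrite psM.
Qed.

Lemma theta_shift j F : theta (iter j psDelta F) = iter j (@pshift _) (theta F).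
Proof.
elim: j => //= j <-; apply: psP => i; apply: psP => n /=.
by rewrite taylorS.
Qed.

Definition monomial (c : k) (m : nat) : ps k := pC c * pX _ ^+ m.

Lemma monomialE c m n : monomial c m n = c * (n == m)%:R.
Proof. by rewrite pCM pXn. Qed.

Lemma regular_monomial p m : regular (monomial (frac p) m).
Proof.
move=> n; rewrite monomialE; case: eqP => _; rewrite ?mulr1 ?mulr0.
  exact: nopole0_poly.
exact: nopole0_0.
Qed.

Lemma theta_monomial p m i : theta (monomial (frac p) m) i = monomial (rcst p`_i) m.
Proof.
apply: psP => n; rewrite thetaE !monomialE; case: eqP => _; rewrite ?mulr1 ?mulr0.
  by rewrite taylor_poly.
by rewrite taylor0 /rcst !rmorph0.
Qed.

Lemma ispoly_theta_monomial p m : ps_ispoly (theta (monomial (frac p) m)).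
Proof.
exists (size p) => i pi; rewrite theta_monomial nth_default // /monomial.
by rewrite /rcst !rmorph0 mul0r.
Qed.

Lemma monomial_C c : monomial c 0 = pC c.
Proof. by rewrite /monomial mulr1. Qed.

Lemma theta_Xn r : theta (monomial (frac 'X^r) 0) = pX _ ^+ r.
Proof.
apply: psP => i; rewrite theta_monomial monomial_C coefXn pXn /rcst.
by case: eqP => _; rewrite ?rmorph1 ?rmorph0.
Qed.

Lemma theta_t : theta (monomial 1 1) = tau k.
Proof.
rewrite -(rmorph1 frac); apply: psP => -[|i].
  by rewrite theta_monomial coef1 /monomial expr1 /rcst !rmorph1 mul1r.
by rewrite theta_monomial coef1 /monomial /rcst !rmorph0 mul0r.
Qed.

Lemma theta_inv (q : {poly K}) : q.[0] != 0 ->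
  exists h, h * theta (monomial (frac q) 0) = 1.
Proof.
move=> q0; exists (theta (monomial (frac q)^-1 0)).
rewrite -thetaM; last exact: regular_monomial.
  rewrite !monomial_C -rmorphM mulVf ?frac_eval_neq0 //.
  have := theta_Xn 0; rewrite !expr0 rmorph1 monomial_C => ->.
  by [].
move=> n; rewrite monomialE; case: eqP => _; rewrite ?mulr1 ?mulr0; last exact: nopole0_0.
by exists 1, q; rewrite rmorph1 mul1r.
Qed.

Lemma theta_pval (C : Type) N (phi : C -> ps k) (y : 'I_N -> ps k) e :
  (forall c, regular (phi c)) -> (forall j, regular (y j)) ->
  regular (pval phi y e) /\
  theta (pval phi y e) = pval (fun c => theta (phi c)) (fun j => theta (y j)) e.
Proof.
move=> hphi hy; elim: e => //= [n|e1 [r1 IH1] e2 [r2 IH2]|e1 [r1 IH1] e2 [r2 IH2]].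
- have nE : (n%:R : ps k) = monomial (frac n%:R) 0.
    by rewrite monomial_C !rmorph_nat.
  rewrite nE; split; first exact: regular_monomial.
  apply: psP => i; rewrite theta_monomial monomial_C -(rmorph_nat (@pC _)) /=.
  rewrite -polyC_natr coefC; case: i => [|i] /=; last by rewrite /rcst !rmorph0.
  by rewrite /rcst polyC_natr !rmorph_nat.
- by split; [apply: regularD | rewrite thetaD // IH1 IH2].
- by split; [apply: regularM | rewrite thetaM // IH1 IH2].
Qed.

(** * Encoded polynomials as expressions *)

Section MultipolyExpression.
Variable n : nat.
Local Notation mono := (k * ({ffun 'I_n.+1 -> nat} * nat))%type.

Definition mexp (m : {ffun 'I_n.+1 -> nat}) : pexp mono n.+1 :=
  foldr (fun i acc => PMul (iter (m i) (PMul (PVar _ i)) (PNat 1)) acc)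
    (PNat 1) (enum 'I_n.+1).

(** Each whole monomial serves as the constant of its term: its coefficient and its power of t enter
    through [phi] alone, so clearing denominators only changes [phi]. *)
Definition Qexp (Q : multipoly K n) : pexp mono n.+1 :=
  foldr (fun mon acc => PAdd (PMul (PCst _ mon) (mexp mon.2.1)) acc) (PNat 0) Q.

Lemma pval_mexp (A : comNzRingType) (phi phi' : mono -> A) y m :
  pval phi y (mexp m) = pval phi' y (mexp m).
Proof.
rewrite /mexp; elim: (enum _) => //= i s ->; congr (_ * _).
by elim: (m i) => //= j ->.
Qed.

Lemma pval_Qexp_scale (A : comNzRingType) (phi phi' : mono -> A) y a Q :
  (forall mon, mon \in Q -> phi' mon = a * phi mon) ->
  pval phi' y (Qexp Q) = a * pval phi y (Qexp Q).
Proof.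
elim: Q => [|mon Q IH] h /=; first by rewrite mulr0.
rewrite IH => [|m mQ]; last by apply: h; rewrite inE mQ orbT.
by rewrite h ?mem_head // (pval_mexp phi' phi) mulrDr mulrA.
Qed.

Definition mono_val (mon : mono) : ps k := monomial mon.1 mon.2.2.

Lemma ps_spow (F : series K) m : PS (spow F m) = PS F ^+ m.
Proof.
elim: m => [|m IH]; first by apply: psP => -[|i].
rewrite exprS -IH; exact: psP.
Qed.

Lemma ps_iter_Delta (F : series K) j : PS (iter j (@Delta K) F) = iter j psDelta (PS F).
Proof. by elim: j => //= j <-. Qed.

Lemma evalQ_pval (Q : multipoly K n) (F : series K) :
  PS (evalQ Q F) = pval mono_val (fun j => iter j psDelta (PS F)) (Qexp Q).
Proof.
elim: Q => [|mon Q IH] /=; first exact: psP.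
rewrite -IH; set acc := foldr _ (sone K) _.
have -> : pval mono_val (fun j => iter j psDelta (PS F)) (mexp mon.2.1) = PS acc.
  rewrite /acc /mexp; elim: (enum _) => [|i s IHs] /=; first by apply: psP => -[|i].
  rewrite IHs; set b := pval _ _ _.
  have -> : b = PS (spow (iter i (@Delta K) F) (mon.2.1 i)).
    rewrite ps_spow ps_iter_Delta /b; elim: (mon.2.1 i) => //= m ->.
    by rewrite exprS.
  exact: psP.
have tE : PS (tpow K mon.2.2) = pX k ^+ mon.2.2.
  by apply: psP => i; rewrite pXn /= /tpow; case: eqP.
rewrite /mono_val /monomial -mulrA -tE; apply: psP => i.
rewrite psD pCM; congr (_ + _).
Qed.

End MultipolyExpression.

Lemma clear_denominators (s : seq k) : exists d : {poly K}, d != 0 /\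
  forall x, x \in s -> exists p, frac d * x = frac p.
Proof.
elim: s => [|x s [d [d0 IH]]]; first by exists 1; rewrite oner_neq0.
have [a [b [b0 xE]]] := fraction_repr x.
exists (b * d); rewrite mulf_neq0 //; split=> // z; rewrite inE => /orP[/eqP->|/IH[p pE]].
  exists (d * a); rewrite xE !rmorphM /= mulrA [_ * frac d]mulrC -mulrA.
  by rewrite -mulrA [frac b * _]mulrC divfK ?tofrac_eq0.
by exists (b * p); rewrite !rmorphM -mulrA pE.
Qed.

Lemma split_at0 (d : {poly K}) : d != 0 -> exists r d1, d1.[0] != 0 /\ d = 'X^r * d1.
Proof.
move=> d0; have [r [d1]] := multiplicity_XsubC d 0.
by rewrite d0 /= subr0 => d10 ->; exists r, d1; rewrite mulrC.
Qed.

End Expansion.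

(** * Algebraicity of the solution *)

Section PolynomialSeries.
Variable R : comNzRingType.
Definition poly_ps (p : {poly R}) : ps R := PS (fun n => p`_n).
Fact poly_ps_is_zmod : zmod_morphism poly_ps.
Proof. by move=> p q; apply: psP => n; rewrite psB /= coefB. Qed.
Fact poly_ps_is_monoid : monoid_morphism poly_ps.
Proof.
by split=> [|p q]; apply: psP => n; [rewrite /= coef1 | rewrite psM /= coefM].
Qed.
HB.instance Definition _ :=
  GRing.isZmodMorphism.Build {poly R} (ps R) poly_ps poly_ps_is_zmod.
HB.instance Definition _ :=
  GRing.isMonoidMorphism.Build {poly R} (ps R) poly_ps poly_ps_is_monoid.

Lemma poly_ps_monomial c m : poly_ps (c%:P * 'X^m) = pC c * pX _ ^+ m.
Proof. by apply: psP => n; rewrite pCM pXn /= coefCM coefXn. Qed.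
End PolynomialSeries.

Section CatalyticEquation.
Variables (K : fieldType) (N : nat) (F : series K) (F0 : ratf K) (Q : multipoly K N).
Local Notation k := (ratf K).
Local Notation S := (ps k).
Local Notation fracp := (@FracField.tofrac {poly K}).
Local Notation frac := (@FracField.tofrac S).
Local Notation E := {fraction S}.

Hypothesis F_regular : forall n, nopole0 (F n).
Hypothesis FE : forall n, F n = sadd (sconst F0) (smul (tpow K 1) (evalQ Q F)) n.

Let f : S := PS F.
Let y (j : 'I_N.+1) : S := iter j (@psDelta K) f.
Let e := Qexp Q.

Lemma equation_ps : f = pC F0 + pX _ * pval (@mono_val K N) y e.
Proof.
have -> : pX k = PS (tpow K 1) by apply: psP => i; rewrite /= /tpow; case: eqP.
by rewrite /e -evalQ_pval; apply: psP => n; apply: FE.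
Qed.

(* Clearing denominators in [u] makes the coefficients polynomial, so that the
   equation can be expanded at [u = 0]. *)
Lemma expanded_equation : exists (d d1 p0 : {poly K}) r
    (phi : k * ({ffun 'I_N.+1 -> nat} * nat) -> {poly K}),
  [/\ d1.[0] != 0, d = 'X^r * d1 &
  theta (monomial (fracp d) 0) * theta f = theta (monomial (fracp p0) 0) +
    tau k * pval (fun mon => theta (monomial (fracp (phi mon)) mon.2.2))
       (fun j => iter j (@pshift _) (theta f)) e].
Proof.
have [d [d0 dP]] := clear_denominators (F0 :: [seq mon.1 | mon <- Q]).
have [r [d1 [d10 dE]]] := split_at0 d0.
have [p0 p0E] : exists p0, fracp d * F0 = fracp p0 by apply: dP; rewrite mem_head.
(* The default 0 makes [phi] total; on the monomials of [Q] the polynomial exists by the choice of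
   [d]. *)
pose phi (mon : k * ({ffun 'I_N.+1 -> nat} * nat)) :=
  if pselect (exists p, fracp d * mon.1 = fracp p) is left H then projT1 (cid H) else 0.
exists d, d1, p0, r, phi; split=> //.
pose phi' mon : S := monomial (fracp (phi mon)) mon.2.2.
have phiE : pval phi' y e = pC (fracp d) * pval (@mono_val K N) y e.
  apply: pval_Qexp_scale => mon monQ; rewrite /phi' /mono_val /monomial mulrA -rmorphM.
  congr (pC _ * _); rewrite /phi; case: pselect => [H|[]]; first by case: cid.
  by apply: dP; rewrite inE (map_f _ monQ) orbT.
have f_reg : regular f by [].
have y_reg j : regular (y j) by apply: regularDelta.
have phi'_reg mon : regular (phi' mon) by apply: regular_monomial.
have [Q_reg QE] := theta_pval e phi'_reg y_reg.
rewrite -thetaM //; last exact: regular_monomial.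
have t_reg : regular (monomial (1 : k) 1).
  by rewrite -(rmorph1 fracp); apply: regular_monomial.
have -> : monomial (fracp d) 0 * f = monomial (fracp p0) 0 + monomial 1 1 * pval phi' y e.
  rewrite [in LHS]equation_ps phiE !monomial_C mulrDr -rmorphM /= p0E; congr (_ + _).
  by rewrite /monomial rmorph1 mul1r expr1; ring.
rewrite thetaD; [|exact: regular_monomial|exact: regularM].
rewrite thetaM // theta_t QE; congr (_ + _ * pval _ _ _).
by apply: funext => j; rewrite theta_shift.
Qed.

Section WithDerivation.
Variable D : E -> E.
Hypothesis derD : derivation D.
Hypothesis Dpoly : forall p, D (frac (poly_ps p)) = 0.

Lemma D_monomial c m : D (frac (monomial c m)) = 0.
Proof. by rewrite /monomial -poly_ps_monomial Dpoly. Qed.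

(** The cleared data have as coefficients in v monomials in t over K, which [D] kills, so
    [solution_coef_constant] applies. *)
Lemma D_theta i : D (frac (theta f i)) = 0.
Proof.
have [d [d1 [p0 [r [phi [d10 dE eqE]]]]]] := expanded_equation.
have [d1' d1'd1] := theta_inv d10.
have Dmon p m : cder D (ps_map frac (theta (monomial (fracp p) m))) = 0.
  apply: psP => j; transitivity (D (frac (theta (monomial (fracp p) m) j))) => //.
  by rewrite theta_monomial D_monomial.
apply: (solution_coef_constant derD _ _ _ _ _ _ _ _ d1'd1 eqE) => //.
- by have := D_monomial 1 1; rewrite /monomial rmorph1 mul1r expr1.
- by move=> mon; apply: ispoly_theta_monomial.
- exact: ispoly_theta_monomial.
- exact: ispoly_theta_monomial.
- rewrite dE rmorphM -theta_Xn -thetaM; try exact: regular_monomial.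
  by rewrite !monomial_C rmorphM.
Qed.

(** One step sends [g] to [(g - g(0)) / u]; [D] kills [1/u] and, by [D_theta], also [g(0)], which is
    a coefficient of [theta f]. *)
Lemma D_iter_Delta j : D (frac (iter j (@psDelta K) f)) =
  D (frac f) * frac (pC (ru K)^-1) ^+ j.
Proof.
elim: j => [|j IH]; first by rewrite mulr1.
rewrite exprSr mulrA -IH iterS; set g := iter j _ f.
have -> : psDelta g = (g - theta g 0%N) * pC (ru K)^-1.
  by apply: psP => n; rewrite mulrC pCM psB mulrC.
have g0 : D (frac (theta g 0%N)) = 0 by rewrite theta_shift iter_pshift D_theta.
have Du : D (frac (pC (ru K)^-1)) = 0 by rewrite -monomial_C D_monomial.
by rewrite rmorphM derD.2 Du mulr0 addr0 rmorphB (derDB derD) /= g0 subr0.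
Qed.

Lemma D_solution : D (frac f) = 0.
Proof.
(* Once the equation is differentiated, every remaining term on the right is a multiple of
   [D(f)]. *)
have eD : D (frac f) = frac (pX k) *
    \sum_j frac (pdif (@mono_val K N) y j e * pC (ru K)^-1 ^+ j) * D (frac f).
  rewrite {1}equation_ps rmorphD rmorphM derD.1 derD.2 /=.
  have -> : D (frac (pC F0)) = 0 by rewrite -monomial_C D_monomial.
  have -> : D (frac (pX k)) = 0.
    by have := D_monomial 1 1; rewrite /monomial rmorph1 mul1r expr1.
  rewrite mul0r !add0r pval_morph (pval_derivation _ _ derD); last first.
    by move=> c; apply: D_monomial.
  congr (_ * _); apply: eq_bigr => j _; rewrite -pdif_morph D_iter_Delta.
  by rewrite rmorphM rmorphXn /=; ring.
move: eD; rewrite -mulr_suml mulrA => /eqP.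
rewrite -{1}[D _]mul1r -subr_eq0 -mulrBl mulf_eq0 => /orP[|/eqP//].
rewrite -rmorph_sum -rmorphM -(rmorph1 frac) -rmorphB tofrac_eq0.
(* The factor [1 - t (...)] has constant coefficient 1 in t, so it is nonzero. *)
by move=> /eqP/(congr1 (fun x : S => x 0%N))/eqP; rewrite psB pXM subr0 oner_eq0.
Qed.

End WithDerivation.
End CatalyticEquation.

Lemma pchar_frac_ps (K : fieldType) :
  [pchar K] =i pred0 -> [pchar {fraction (ps (ratf K))}] =i pred0.
Proof.
pose h : {rmorphism K -> {fraction (ps (ratf K))}} :=
  @FracField.tofrac _ \o @pC _ \o @FracField.tofrac _ \o polyC.
by move=> cK p; rewrite (fmorph_pchar h) cK.
Qed.

(** The relation holds in the fraction field; injectivity of the embedding brings it back to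
    series. *)
Lemma algebraic_series_of_root (K : fieldType) (F : series K) (p : {poly {poly (ratf K)}}) :
  let phi := @FracField.tofrac (ps (ratf K)) \o @poly_ps (ratf K) in
  map_poly phi p != 0 -> root (map_poly phi p) (FracField.tofrac (PS F)) ->
  algebraic_series F.
Proof.
move=> phi p0 /rootP; rewrite (horner_coef_wide _ (size_poly _ _)) => pF.
exists p; split; first by apply: contraNneq p0 => ->; rewrite rmorph0.
have {}pF : \sum_(i < size p) poly_ps p`_i * PS F ^+ i = 0.
  apply/eqP; rewrite -tofrac_eq0 rmorph_sum -[X in _ == X]pF; apply/eqP/eq_bigr => i _.
  by rewrite coef_map rmorphM rmorphXn.
move=> n; transitivity ((0 : ps (ratf K)) n) => //; rewrite -pF ps_sum.
by apply: eq_bigr => i _; rewrite -ps_spow.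
Qed.

Theorem theorem9p1 (K : fieldType) (charK0 : [pchar K] =i pred0)
    (F : series K) (k : nat) (F0 : ratf K) (Q : multipoly K k) :
  (forall n, nopole0 (F n)) ->
  (forall n, F n = sadd (sconst F0) (smul (tpow K 1) (evalQ Q F)) n) ->
  algebraic_series F.
Proof.
move=> F_regular FE.
(* Otherwise some derivation kills K(u)[t] and sends [F] to 1, against [D_solution]. *)
have [[p [p0 pF]]|[D [derD Dpoly D1]]] := algebraic_or_derivation
  (pchar_frac_ps charK0) (@FracField.tofrac (ps (ratf K)) \o @poly_ps (ratf K))
  (FracField.tofrac (PS F)).
  exact: algebraic_series_of_root p0 pF.
have /eqP := D_solution F_regular FE derD Dpoly.
by rewrite D1 oner_eq0.
Qed.
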